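(* Along the symplectic leaves of the Poisson structure $\Pi_{X_0}$ on $X_0=G_0/K$, the two-form $\Pi_{X_0}^{-1}$ agrees with the restriction of the closed two-form $\omega_{\mathbf w_1}$ on $G_0/K$ with $\mathbf w_1=1\in U$, that is, of the global closed two-form $$\omega_1([g_0,x]\wedge[g_0,y])=\langle\mathrm{Ad}(\mathbf u(g_0)^{-1})\circ\mathcal H\circ\mathrm{Ad}(\mathbf u(g_0))(x),y\rangle,\qquad g_0\in G_0,\ x,y\in\mathfrak p.$$
   Context: Setup. $U$ is a simply connected compact Lie group, $\Theta$ an involution of $U$, $K$ the identity component of the fixed point set of $\Theta$ in $U$, and $X=U/K$ is assumed to be an irreducible (compact type) symmetric space. $G$ is the complexification of $U$, with Lie algebra $\mathfrak g=\mathfrak u+i\mathfrak u$, $\mathfrak u=\mathrm{Lie}(U)$; $\Theta$ also denotes its holomorphic extension to $G$ and the corresponding Lie algebra maps. $g\mapsto g^{-*}$ is the antiholomorphic Cartan involution of $G$ fixing $U$ (on $\mathfrak g$: $x\mapsto -x^*$), and $\sigma(g)=\Theta(g^{-*})$; $G_0$ is the corresponding real form (fixed by $\sigma$), with Lie algebra $\mathfrak g_0$. Writing $\Theta=+1$ on $\mathfrak k=\mathrm{Lie}(K)$ and $-1$ on $\mathfrak p$, one has $\mathfrak u=\mathfrak k+i\mathfrak p$ and $\mathfrak g_0=\mathfrak k+\mathfrak p$. Fix $\mathfrak t_0\subset\mathfrak k$ maximal abelian; the centralizer of $\mathfrak t_0$ in $\mathfrak g_0$ is $\mathfrak h_0=\mathfrak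 t_0+\mathfrak a_0$ with $\mathfrak a_0\subset\mathfrak p$; put $\mathfrak t=\mathfrak t_0+i\mathfrak a_0$, $\mathfrak h=\mathfrak h_0^{\mathbb C}$, $\mathfrak a=i\mathfrak t=i\mathfrak t_0+\mathfrak a_0$ ($\mathfrak h_0,\mathfrak t,\mathfrak h$ are Cartan subalgebras of $\mathfrak g_0,\mathfrak u,\mathfrak g$). Fix a $\Theta$-stable triangular decomposition $\mathfrak g=\mathfrak n^-+\mathfrak h+\mathfrak n^+$ ($\mathfrak n^{+}$, $\mathfrak n^-$ the sums of the positive, respectively negative, root spaces), so $\sigma(\mathfrak n^\pm)=\mathfrak n^\mp$; write $x=x_-+x_0+x_+$ accordingly. $N^-=\exp\mathfrak n^-$, $A=\exp\mathfrak a$. Each $g\in G$ factors uniquely as $g=\mathbf l(g)\mathbf a(g)\mathbf u(g)$ in the Iwasawa decomposition $G=N^-AU$. $\langle\cdot,\cdot\rangle$ is the (complex bilinear) Killing form of $\mathfrak g$. $\mathcal H:\mathfrak g\to\mathfrak g$ is $\mathcal H(x)=-ix_-+ix_+$. $\{\cdot\}_{\mathfrak p}$ is the orthogonal projection onto $\mathfrak p$. Using the Killing form to identify $\mathfrak p^*$ with $\mathfrak p$, both $T(G_0/K)$ and $T^*(G_0/K)$ are identified with $G_0\times_K\mathfrak p$; $[g_0,x]$ as a tangent vector is $\frac{d}{d\varepsilon}|_{\varepsilon=0}g_0e^{\varepsilon x}K$. For $\mathbf w_1\in U$, the closed two-form $\omega_{\mathbf w_1}$ on $G_0/K$ is $\omega_{\mathbf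 w_1}([g_0,x]\wedge[g_0,y])=\langle\mathrm{Ad}(\mathbf u(\mathbf w_1g_0)^{-1})\circ\mathcal H\circ\mathrm{Ad}(\mathbf u(\mathbf w_1g_0))(x),y\rangle$. The (Evens-Lu) Poisson structure on $X_0=G_0/K$ is $\Pi_{X_0}([g_0,\phi]\wedge[g_0,\psi])=\langle\Omega(g_0)(\phi),\psi\rangle$ for cotangent vectors $[g_0,\phi],[g_0,\psi]$, where $\Omega(g_0)\in\mathfrak{so}(\mathfrak p)$ is $\Omega(g_0)(\phi)=\{\mathrm{Ad}(g_0)^{-1}\circ\mathcal H\circ\mathrm{Ad}(g_0)(\phi)\}_{\mathfrak p}$, with anchor map $\Pi_{X_0}^\#([g_0,\phi])=[g_0,\Omega(g_0)(\phi)]$. For vectors $[g_0,x],[g_0,y]$ tangent to the symplectic leaf through $g_0K$ (that is, $x,y$ in the image of $\Omega(g_0)$), $\Pi_{X_0}^{-1}([g_0,x]\wedge[g_0,y])=\langle\Omega(g_0)^{-1}(x),y\rangle$, where the inverse of $\Omega(g_0)$ is computed on the orthogonal complement of its kernel.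
   Formalization: With the stated formula for the inverse of the Poisson structure the equality fails by a sign (at g0 = 1, Ω(1) = H on p and H² = −1 off h; e.g. SU(2)/U(1)); the formal theorem proves that Π⁻¹ equals −ω₁ along the leaves. *)

(* Defs.v *)
From HB Require Import structures.
From mathcomp Require Import all_boot all_order all_algebra.
From mathcomp Require Import complex.
From mathcomp Require Import all_classical all_reals all_analysis.

Set Implicit Arguments.
Unset Strict Implicit.
Unset Printing Implicit Defensive.

Import Order.TTheory GRing.Theory Num.Theory numFieldNormedType.Exports.

Local Open Scope classical_set_scope.
Local Open Scope ring_scope.
Local Open Scope complex_scope.
Local Open Scope sesquilinear_scope.

(* The usual topology of the complex numbers; matrices over R[i] inherit it. *)
HB.instance Definition _ (R : realType) := NormedModule.copy R[i] R[i]^o.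

(* Span of a set of vectors. Since {vspace V} is complex linear here, the span
   of a real Lie algebra v of matrices is v + iv. *)
Section Span.
Variables (K : fieldType) (V : vectType K).

Definition is_vspan (S : set V) (W : {vspace V}) : Prop :=
  (forall x, S x -> x \in W) /\
  (forall W' : {vspace V}, (forall x, S x -> x \in W') -> (W <= W')%VS).

Definition vspan (S : set V) : {vspace V} := xget 0%VS (is_vspan S).

Lemma vspanP (S : set V) : is_vspan S (vspan S).
Proof.
apply: xgetPex.
pose P d := `[< exists2 W : {vspace V}, (forall x, S x -> x \in W) & \dim W = d >].
have exP : exists d, P d.
  exists (\dim (fullv : {vspace V})); apply/asboolP; exists fullv => // x _.
  exact: memvf.
case: (ex_minnP exP) => d /asboolP[W SW dW] dmin.
exists W; split=> // W' SW'.
have SI x : S x -> x \in (W :&: W')%VS.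
  by move=> Sx; rewrite memv_cap SW ?SW'.
have le_d : (d <= \dim (W :&: W'))%N.
  by apply: dmin; apply/asboolP; exists (W :&: W')%VS.
have /eqP <- : (W :&: W' == W)%VS by rewrite eqEdim capvSl dW.
exact: capvSr.
Qed.

End Span.

(* A is path connected and every loop in A contracts, relative to its base
   point, inside A. *)
Definition simply_connected (R : realType) (T : topologicalType) (A : set T) :=
  (forall x y, A x -> A y -> exists c : R -> T,
     [/\ {within `[0%R, 1%R]%classic, continuous c}, c 0 = x, c 1 = y
       & forall s : R, 0 <= s <= 1 -> A (c s)]) /\
  (forall c : R -> T, {within `[0%R, 1%R]%classic, continuous c} ->
     (forall s : R, 0 <= s <= 1 -> A (c s)) -> c 0 = c 1 ->
     exists F : R * R -> T,
       [/\ {within `[0%R, 1%R]%classic `*` `[0%R, 1%R]%classic, continuous F},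
           forall s t : R, 0 <= s <= 1 -> 0 <= t <= 1 -> A (F (s, t)),
           forall t : R, 0 <= t <= 1 -> F (0, t) = c t,
           forall t : R, 0 <= t <= 1 -> F (1, t) = c 0
         & forall s : R, 0 <= s <= 1 -> F (s, 0) = c 0 /\ F (s, 1) = c 0]).

Section Matrices.
Variables (R : realType) (n : nat).
Local Notation M := 'M[R[i]]_n.

Definition mexp (X : M) : M :=
  limn (series (fun k => (k`!%:R : R[i])^-1 *: X ^+ k)).

Definition lie (X Y : M) : M := X *m Y - Y *m X.

Definition Ad (g X : M) : M := g *m X *m invmx g.

Definition mx_subgroup (H : set M) : Prop :=
  [/\ H `<=` [set g | g \in unitmx], H 1%:M,
      (forall g h, H g -> H h -> H (g *m h))
    & (forall g, H g -> H (invmx g))].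

Definition real_subspace (V : set M) : Prop :=
  [/\ V 0, (forall X Y, V X -> V Y -> V (X + Y))
    & (forall (t : R) X, V X -> V (t%:C *: X))].

(* The Lie algebra of a closed matrix group. Below, fu, fg, fk, fp, ... stand
   for the fraktur letters u, g, k, p, ... *)
Definition lie_alg (H : set M) : set M :=
  [set X | forall t : R, H (mexp (t%:C *: X))].

(* Up to isomorphism every compact Lie group is a compact group of unitary
   matrices. With this realization x |-> x^* is the conjugate transpose. *)
Definition compact_unitary_group (U : set M) : Prop :=
  [/\ mx_subgroup U, U `<=` [set g | g \is unitarymx] & compact U].

Definition cstar_inv (g : M) : M := invmx (g ^t* ).

Section Complexification.
Variable U : set M.

Definition fu : set M := lie_alg U.
Definition fg : {vspace M} := vspan fu.

(* For U connected, the complexification of U is the connected subgroup of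
   GL_n(C) with Lie algebra fu + i fu. *)
Definition grpG : set M :=
  [set g | forall H : set M, mx_subgroup H ->
             (forall X, X \in fg -> H (mexp X)) -> H g].

Definition killing (X Y : M) : R[i] :=
  \sum_(j < \dim fg)
    coord (vbasis fg) j (lie X (lie Y (vbasis fg)`_j)).

(* The orthogonal projection of w onto a real subspace W. *)
Definition orth_proj (W : set M) (w : M) : M :=
  xget 0 [set v | W v /\ forall y, W y -> killing (w - v) y = 0].

(* Theta is a holomorphic automorphism of G extending an involution of U; its
   differential dTheta is the complex linear map of fg that Theta intertwines
   with through the exponential (only the values on G, resp. fg, matter). *)
Definition holomorphic_involution (Theta : M -> M) (dTheta : 'End(M)) : Prop :=
  [/\ (forall g, grpG g -> grpG (Theta g)),
      (forall g h, grpG g -> grpG h -> Theta (g *m h) = Theta g *m Theta h),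
      (forall g, grpG g -> Theta (Theta g) = g) &
      (forall g, U g -> U (Theta g))] /\
  (forall X, X \in fg ->
     dTheta X \in fg /\ Theta (mexp X) = mexp (dTheta X)).

Section Involution.
Variables (Theta : M -> M) (dTheta : 'End(M)).

Definition grpK : set M :=
  connected_component [set g | U g /\ Theta g = g] 1%:M.
Definition fk : set M := lie_alg grpK.
Definition fp : set M := [set X | fu ('i *: X) /\ dTheta X = - X].

Definition sigma (g : M) : M := Theta (cstar_inv g).
Definition dsigma (X : M) : M := dTheta (- X ^t* ).
Definition grpG0 : set M := [set g | grpG g /\ sigma g = g].
Definition fg0 : set M := [set X | X \in fg /\ dsigma X = X].

(* U/K is of compact type (fu is semisimple with negative definite Killing
   form) and the isotropy representation of K on fp ~ T_o(U/K) is
   irreducible. *)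
Definition irreducible_compact_type : Prop :=
  [/\ (forall X, fu X -> X <> 0 -> killing X X < 0),
      (exists2 X, fp X & X <> 0) &
      (forall V : set M, real_subspace V -> V `<=` fp ->
         (forall c X, grpK c -> V X -> V (Ad c X)) ->
         V = [set 0] \/ V = fp)].

(* t0 is automatically a real subspace, by maximality. *)
Definition maximal_abelian (t0 : set M) : Prop :=
  [/\ t0 `<=` fk, (forall X Y, t0 X -> t0 Y -> lie X Y = 0)
    & (forall X, fk X -> (forall Y, t0 Y -> lie X Y = 0) -> t0 X)].

Section Cartan.
Variable t0 : set M.

Definition fh0 : set M := [set X | fg0 X /\ forall Y, t0 Y -> lie X Y = 0].
Definition fa0 : set M := fh0 `&` fp.
Definition fh : {vspace M} := vspan fh0.
Definition fa : set M :=
  [set 'i *: T + Y | T in t0 & Y in fa0].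

Definition root_space (al : 'Hom(subvs_of fh, R[i]^o)) : set M :=
  [set X | X \in fg /\
           forall H : subvs_of fh, lie (vsval H) X = (al H : R[i]) *: X].

Definition roots : set 'Hom(subvs_of fh, R[i]^o) :=
  [set al | al <> 0 /\ exists2 X, root_space al X & X <> 0].

Definition positive_system (P : set 'Hom(subvs_of fh, R[i]^o)) : Prop :=
  [/\ P `<=` roots,
      (forall al, roots al -> (P al \/ P (- al)) /\ ~ (P al /\ P (- al)))
    & (forall al be, P al -> P be -> roots (al + be) -> P (al + be))].

Section Triangular.
Variable P : set 'Hom(subvs_of fh, R[i]^o).

Definition nplus : {vspace M} := vspan (\bigcup_(al in P) root_space al).
Definition nminus : {vspace M} := vspan (\bigcup_(al in P) root_space (- al)).

Definition theta_stable_triangular : Prop :=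
  [/\ positive_system P,
      (nminus + fh + nplus)%VS = fg /\ directv (nminus + fh + nplus),
      (forall X, X \in nplus -> dTheta X \in nplus)
    & (forall X, X \in nminus -> dTheta X \in nminus)].

Definition proj_minus : 'End(M) := daddv_pi nminus (fh + nplus)%VS.
Definition proj_plus : 'End(M) := daddv_pi nplus (nminus + fh)%VS.

Definition hilb (X : M) : M := - ('i *: proj_minus X) + 'i *: proj_plus X.

Definition grpNminus : set M := mexp @` [set X | X \in nminus].
Definition grpA : set M := mexp @` fa.

(* l, a, u are the factors in the Iwasawa decomposition G = N^- A U. *)
Definition iwasawa (l a u : M -> M) : Prop :=
  forall g, grpG g ->
    [/\ grpNminus (l g), grpA (a g), U (u g) & g = l g *m a g *m u g].

Definition omega (u : M -> M) (w1 g0 x y : M) : R[i] :=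
  killing (Ad (invmx (u (w1 *m g0))) (hilb (Ad (u (w1 *m g0)) x))) y.

Definition Omega (g0 phi : M) : M :=
  orth_proj fp (Ad (invmx g0) (hilb (Ad g0 phi))).

(* The Poisson bivector, and the tangent space to the symplectic leaf through
   g0 K, i.e. the image of the anchor map [g0, phi] |-> [g0, Omega g0 phi]. *)
Definition Pi (g0 phi psi : M) : R[i] := killing (Omega g0 phi) psi.
Definition leaf_tangent (g0 : M) : set M := Omega g0 @` fp.

(* Inverse of Omega g0, computed on the orthogonal complement of its kernel. *)
Definition Omega_inv (g0 x : M) : M :=
  xget 0 [set phi | [/\ fp phi, Omega g0 phi = x &
    forall psi, fp psi -> Omega g0 psi = 0 -> killing phi psi = 0]].

(* With these conventions the leafwise form and omega differ by a sign: at
   g0 = 1 one has u(1) = 1 and Omega 1 = hilb on fp, where hilb^2 = -1 off the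
   zero weight space, hence Omega_inv 1 = - hilb on the image of Omega 1.
   Equivalently omega (Omega phi) (Omega psi) = Pi phi psi, so omega is the
   leafwise symplectic form normalized by omega (Pi^# phi, Pi^# psi) =
   Pi (phi, psi), while Pi_inv is its negative. *)
Definition Pi_inv (g0 x y : M) : R[i] := killing (Omega_inv g0 x) y.

End Triangular.
End Cartan.
End Involution.
End Complexification.
End Matrices.

(* Main.v *)
Require Import Defs.
From HB Require Import structures.
From mathcomp Require Import all_boot all_order all_algebra.
From mathcomp Require Import complex.
From mathcomp Require Import all_classical all_reals all_analysis.
From mathcomp Require Import ring.

Set Implicit Arguments.
Unset Strict Implicit.
Unset Printing Implicit Defensive.

Import Order.TTheory GRing.Theory Num.Theory numFieldNormedType.Exports.

Local Open Scope classical_set_scope.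
Local Open Scope ring_scope.

(** The proof compares, at a point g0 of G0, the operator hilb conjugated by g0 with hilb
    conjugated by the unitary Iwasawa factor k of g0 = l a k, writing b = l a.

    Take phi in p. Since hilb commutes with the conjugation of g that fixes the Lie
    algebra k + p of G0, the element Z = Ad(g0)^-1 hilb Ad(g0) phi lies in k + p, so
    Z = x + K with x = Omega g0 phi in p and K in k. On g the operator hilb equals i
    modulo the opposite Borel subalgebra b^- = n^- + h, which Ad(b) preserves; hence
    Ad(k) Z - i Ad(k) phi lies in b^-. This difference is the sum of the Hermitian element
    v = Ad(k) x and of the skew-Hermitian element Ad(k) K - i Ad(k) phi. The conjugate
    transpose exchanges n^- and n^+, so the absence of an n^+ component determines hilb v:
    it is -i Ad(k) K - Ad(k) phi + Y with Y in a0, while v has its h component in i t0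
    (hilb_hermitian_skew, leaf_components). Pairing with Ad(k) y for another leaf vector y
    kills the term in K, because k and p are Killing-orthogonal, and the term in Y, because
    t0 and a0 are; this gives omega(x,y) = -<phi,y> (omega_leaf). The theorem follows with
    phi the preimage of x under Omega g0 that is orthogonal to the kernel; it exists because
    the Killing form is a real inner product on p (fp_orth_proj, Omega_invP).

    The Lie theory behind this is derived from the definitions of the groups by matrix
    exponentials. The Lie product formula makes u a real subspace, so that g = u + iu is a
    Lie algebra with skew-Hermitian part u, preserved by Ad(G). Differentiating
    one-parameter groups makes dTheta an automorphism of g that commutes with the conjugate
    transpose. The centralizer h0 = t0 + a0 of t0 is abelian because [a0,a0] lies in t0 and
    is orthogonal to it. Roots are real on Hermitian elements of h, so the conjugate
    transpose exchanges n^- and n^+; and exp(ad X) = Ad(exp X) gives the action of N^- A on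
    b^-. *)

(** * An entrywise norm on complex matrices *)

Section MatrixNorm.
Variable R : realType.
Import Normc.
Local Notation C := R[i].

(** Real valued, and submultiplicative by nrmM, so that matrix estimates reduce to
    estimates for the real exponential. *)
Definition nrm m n (X : 'M[C]_(m, n)) : R := \sum_i \sum_j normc (X i j).

Lemma normc_ge0 (z : C) : 0 <= normc z.
Proof. by case: z => a b; rewrite sqrtr_ge0. Qed.

Lemma normc_real (t : R) : normc t%:C%C = `|t|.
Proof. by rewrite /= expr0n addr0 sqrtr_sqr. Qed.

Lemma normc_le_ReIm (z : C) : normc z <= `|complex.Re z| + `|complex.Im z|.
Proof.
case: z => a b /=.
rewrite -[leRHS]ger0_norm ?addr_ge0// -sqrtr_sqr ler_wsqrtr//.
rewrite sqrrD !real_normK ?num_real//.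
by rewrite addrAC lerDl mulrn_wge0// mulr_ge0.
Qed.

Section Rect.
Variables m n : nat.
Implicit Types X Y : 'M[C]_(m, n).

Lemma nrm_ge0 X : 0 <= nrm X.
Proof. by do 2 apply: sumr_ge0 => ? _; exact: normc_ge0. Qed.

Lemma nrmD X Y : nrm (X + Y) <= nrm X + nrm Y.
Proof.
rewrite -big_split ler_sum// => i _; rewrite -big_split ler_sum// => j _.
by rewrite mxE le_normcD.
Qed.

Lemma nrmZ (c : C) X : nrm (c *: X) = normc c * nrm X.
Proof.
rewrite mulr_sumr; apply: eq_bigr => i _; rewrite mulr_sumr.
by apply: eq_bigr => j _; rewrite mxE normcM.
Qed.

Lemma nrmN X : nrm (- X) = nrm X.
Proof. by do 2 apply: eq_bigr => ? _; rewrite mxE normcN. Qed.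

Lemma nrm0 : nrm (0 : 'M[C]_(m, n)) = 0.
Proof. by rewrite /nrm; do 2 apply: big1 => ? _; rewrite mxE normc0. Qed.

Lemma nrmB X Y : nrm (X - Y) = nrm (Y - X).
Proof. by rewrite -nrmN opprB. Qed.

Lemma nrm_triangle Y X Z : nrm (X - Z) <= nrm (X - Y) + nrm (Y - Z).
Proof. by apply: le_trans (nrmD _ _); rewrite addrA subrK. Qed.

Lemma nrm_entry X i j : normc (X i j) <= nrm X.
Proof.
rewrite /nrm (bigD1 i)//= (bigD1 j)//= -addrA lerDl addr_ge0//.
  by apply: sumr_ge0 => ? _; exact: normc_ge0.
by do 2 apply: sumr_ge0 => ? _; exact: normc_ge0.
Qed.

Lemma nrm_eq0 X : nrm X <= 0 -> X = 0.
Proof.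
move=> X0; apply/matrixP => i j; rewrite mxE; apply: eq0_normc; apply/eqP.
by rewrite eq_le normc_ge0 andbT (le_trans (nrm_entry _ _ _)).
Qed.

Lemma nrm_sum (I : Type) (r : seq I) (Q : pred I) (F : I -> 'M[C]_(m, n)) :
  nrm (\sum_(i <- r | Q i) F i) <= \sum_(i <- r | Q i) nrm (F i).
Proof.
elim/big_ind2: _ => //; first by rewrite nrm0.
by move=> x a y b xa yb; rewrite (le_trans (nrmD _ _))// lerD.
Qed.

Lemma nrm_ctr X : nrm (X ^t* )%sesqui = nrm X.
Proof.
rewrite /nrm exchange_big; do 2 apply: eq_bigr => ? _; rewrite !mxE.
by case: (X _ _) => a b; rewrite /= sqrrN.
Qed.

End Rect.

Lemma nrmM m n p (X : 'M[C]_(m, n)) (Y : 'M[C]_(n, p)) :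
  nrm (X *m Y) <= nrm X * nrm Y.
Proof.
rewrite mulr_suml ler_sum// => i _.
apply: (@le_trans _ _ (\sum_k \sum_j normc (X i j) * normc (Y j k))).
  apply: ler_sum => k _; rewrite mxE.
  elim/big_ind2: _ => //; first by rewrite normc0.
    by move=> x a y b xa yb; rewrite (le_trans (le_normcD _ _))// lerD.
  by move=> j _; rewrite normcM.
rewrite exchange_big mulr_suml ler_sum// => j _.
rewrite -mulr_sumr ler_wpM2l ?normc_ge0// /nrm (bigD1 j)//= lerDl.
by do 2 apply: sumr_ge0 => ? _; exact: normc_ge0.
Qed.

(** The matrix units span, so a linear map is bounded by the sum of the norms of
    their images. *)
Lemma nrm_linear_bounded m n p q (f : {linear 'M[C]_(m, n) -> 'M[C]_(p, q)}) :
  exists2 K : R, 0 <= K & forall X, nrm (f X) <= K * nrm X.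
Proof.
exists (\sum_i \sum_j nrm (f (delta_mx i j))).
  by do 2 apply: sumr_ge0 => ? _; exact: nrm_ge0.
move=> X; rewrite {1}(matrix_sum_delta X) linear_sum mulr_suml.
apply: le_trans (nrm_sum _ _ _) _; apply: ler_sum => i _.
rewrite linear_sum mulr_suml.
apply: le_trans (nrm_sum _ _ _) _; apply: ler_sum => j _.
by rewrite linearZ nrmZ mulrC ler_wpM2l ?nrm_ge0 ?nrm_entry.
Qed.

End MatrixNorm.

Section MatrixLimit.
Variables (R : realType) (m n : nat).
Local Notation C := R[i].
Implicit Types (M : nat -> 'M[C]_(m, n)) (L : 'M[C]_(m, n)).

(** Convergence measured by nrm; mlim_lim and mlim_compact transfer it to the
    topology of matrices. *)
Definition mlim M L := (nrm (M k - L)) @[k --> \oo] --> (0 : R).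

Lemma mlimP M L : mlim M L <->
  forall e, 0 < e -> \forall k \near \oo, nrm (M k - L) < e.
Proof.
split=> [/cvgrPdist_lt cM e /cM|cM]; last apply/cvgrPdist_lt => e /cM.
  by apply: filterS => k; rewrite sub0r normrN ger0_norm ?nrm_ge0.
by apply: filterS => k; rewrite sub0r normrN ger0_norm ?nrm_ge0.
Qed.

Lemma mlim_le M L (e : nat -> R) : (forall k, nrm (M k - L) <= e k) ->
  e @ \oo --> (0 : R) -> mlim M L.
Proof.
move=> le_e e0; apply: (squeeze_cvgr _ (cvg_cst 0) e0).
by near=> k; rewrite nrm_ge0 le_e.
Unshelve. all: by end_near. Qed.

(** Closed balls are closed. *)
Lemma mlim_bound M L Z B : mlim M L ->
  (\forall k \near \oo, nrm (M k - Z) <= B) -> nrm (L - Z) <= B.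
Proof.
move=> /mlimP cvM MB; apply/ler_addgt0Pr => e e0.
have cvMe := cvM e e0.
near \oo => k.
rewrite (le_trans (nrm_triangle (M k) _ _))// addrC lerD//; first by near: k.
by rewrite nrmB ltW//; near: k.
Unshelve. all: by end_near. Qed.

Lemma mlim_unique M L L' : mlim M L -> mlim M L' -> L = L'.
Proof.
move=> cL /mlimP cL'; apply/eqP; rewrite -subr_eq0; apply/eqP/nrm_eq0.
apply/ler_addgt0Pr => e e0; rewrite add0r; apply: (mlim_bound cL).
by apply: filterS (cL' e e0) => k; exact: ltW.
Qed.

Lemma mlim_cst L : mlim (fun=> L) L.
Proof.
by apply/mlimP => e e0; apply: nearW => k; rewrite subrr nrm0.
Qed.

Lemma nrm_cvg T (F : set_system T) {FF : Filter F} (f : T -> 'M[C]_(m, n)) L :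
  (nrm (f x - L)) @[x --> F] --> (0 : R) -> f @ F --> L.
Proof.
move=> cM; apply/cvg_ballP => -[e e']; rewrite ltcE /= => /andP[/eqP -> e0].
have /cvgrPdist_lt/(_ e e0) := cM.
apply: filterS => x; rewrite sub0r normrN ger0_norm ?nrm_ge0// => ke.
split=> [|i j]; first by rewrite ltcR.
rewrite /ball /= ltcR -/(Normc.normc _) (le_lt_trans _ ke)// nrmB.
by have := nrm_entry (L - f x) i j; rewrite !mxE.
Qed.

Lemma mlim_lim M L : mlim M L -> limn M = L.
Proof. by move=> /nrm_cvg; apply: cvg_lim; exact: norm_hausdorff. Qed.

(** Compact sets are closed, the space being Hausdorff. *)
Lemma mlim_compact (A : set 'M[C]_(m, n)) M L : compact A ->
  (forall k, A (M k)) -> mlim M L -> A L.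
Proof.
move=> cA AM /nrm_cvg; apply: closed_cvg; last exact: nearW.
by apply: compact_closed => //; exact: norm_hausdorff.
Qed.

End MatrixLimit.

Lemma mlim_lip (R : realType) m n p q (f : 'M[R[i]]_(m, n) -> 'M[R[i]]_(p, q))
    (K : R) M L :
  (forall X Y, nrm (f X - f Y) <= K * nrm (X - Y)) ->
  mlim M L -> mlim (f \o M) (f L).
Proof.
move=> fK cM; apply: (@mlim_le _ _ _ _ _ (fun k => K * nrm (M k - L))) => //=.
by rewrite -(mulr0 K); apply: cvgM => //; exact: cvg_cst.
Qed.

Lemma mlim_linear (R : realType) m n p q
    (f : {linear 'M[R[i]]_(m, n) -> 'M[R[i]]_(p, q)}) M L :
  mlim M L -> mlim (f \o M) (f L).
Proof.
have [K _ fK] := nrm_linear_bounded f.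
by apply: (@mlim_lip _ _ _ _ _ _ K) => X Y; rewrite -linearB.
Qed.

(** W is the kernel of the continuous map id - projv W, hence closed. *)
Lemma mlim_memv (R : realType) n (W : {vspace 'M[R[i]]_n}) M L :
  (forall k, M k \in W) -> mlim M L -> L \in W.
Proof.
move=> WM cM; have cPM := mlim_linear (\1 - projv W)%VF cM.
have e0 : (\1 - projv W)%VF L = 0.
  apply: (mlim_unique cPM); apply/mlimP => e e0; apply: nearW => k.
  by rewrite /= subr0 add_lfunE opp_lfunE id_lfunE projv_id// subrr nrm0.
move/eqP: e0; rewrite add_lfunE opp_lfunE id_lfunE subr_eq0 => /eqP ->.
exact: memv_proj.
Qed.

(** * The matrix exponential *)

Section Exponential.
Variable R : realType.
Import Normc.
Local Notation C := R[i].

Definition pexp n (X : 'M[C]_n) : nat -> 'M[C]_n :=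
  series (fun k => (k`!%:R : C)^-1 *: X ^+ k).

Lemma normc_natV k : normc (k%:R^-1 : C) = k%:R^-1.
Proof.
by rewrite normcV -(rmorph_nat (real_complex R)) normc_real ger0_norm.
Qed.

(** The identity has norm n, so for k = 0 a factor independent of k is needed. *)
Lemma nrmX n (X : 'M[C]_n) k : nrm (X ^+ k) <= n.+1%:R * nrm X ^+ k.
Proof.
elim: k => [|k IH].
  rewrite !expr0 mulr1 /nrm (eq_bigr (fun=> 1)).
    by rewrite sumr_const card_ord ler_nat.
  move=> i _; rewrite (bigD1 i)//= big1 => [|j ji].
    by rewrite addr0 mxE eqxx normc1.
  by rewrite mxE eq_sym (negPf ji) normc0.
rewrite exprSr (le_trans (nrmM _ _))// exprSr mulrA ler_wpM2r//.
exact: nrm_ge0.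
Qed.

Lemma nrm_exp_term n (X : 'M[C]_n) k :
  nrm ((k`!%:R : C)^-1 *: X ^+ k) <= n.+1%:R * exp_coeff (nrm X) k.
Proof.
by rewrite nrmZ normc_natV exp_coeffE mulrCA ler_wpM2l ?invr_ge0 ?nrmX.
Qed.

Lemma ReD (z w : C) : complex.Re (z + w) = complex.Re z + complex.Re w.
Proof. by case: z w => a b [c d]. Qed.

Lemma ImD (z w : C) : complex.Im (z + w) = complex.Im z + complex.Im w.
Proof. by case: z w => a b [c d]. Qed.

Lemma Re_le_normc (z : C) : `|complex.Re z| <= normc z.
Proof. by case: z => a b /=; rewrite -sqrtr_sqr ler_wsqrtr// lerDl sqr_ge0. Qed.

Lemma Im_le_normc (z : C) : `|complex.Im z| <= normc z.
Proof. by case: z => a b /=; rewrite -sqrtr_sqr ler_wsqrtr// lerDr sqr_ge0. Qed.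

Lemma Re_sum (I : Type) (r : seq I) (Q : pred I) (F : I -> C) :
  complex.Re (\sum_(i <- r | Q i) F i) = \sum_(i <- r | Q i) complex.Re (F i).
Proof. exact: (big_morph (@complex.Re R) ReD erefl). Qed.

Lemma Im_sum (I : Type) (r : seq I) (Q : pred I) (F : I -> C) :
  complex.Im (\sum_(i <- r | Q i) F i) = \sum_(i <- r | Q i) complex.Im (F i).
Proof. exact: (big_morph (@complex.Im R) ImD erefl). Qed.

Lemma series_dominated_cvg (u v : nat -> R) (K : R) :
  (forall k, `|u k| <= K * v k) -> cvgn (series v) -> cvgn (series u).
Proof.
move=> uv cv; apply: normed_cvg.
apply: (@series_le_cvg _ _ (fun k => K * v k)) => [k|k|k|] /=.
- exact: normr_ge0.
- exact: le_trans (uv k).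
- exact: uv.
rewrite (_ : series _ = K *: series v); first exact: is_cvgZr.
by apply/funext => k; rewrite /series /= [RHS]mulr_sumr.
Qed.

Lemma cvg_sum0 (I : finType) (f : I -> nat -> R) :
  (forall i, f i @ \oo --> (0 : R)) ->
  (fun k => \sum_i f i k) @ \oo --> (0 : R).
Proof.
move=> f0; rewrite (_ : (fun k => _) = \sum_i f i); last first.
  by apply/funext => k; rewrite fct_sumE.
elim/big_ind: _ => //; first exact: cvg_cst.
by move=> g h g0 h0; rewrite -[0 : R]addr0; exact: cvgD.
Qed.

Lemma cvg_complex (z : nat -> C) (a b : R) :
  (fun k => complex.Re (z k)) @ \oo --> a ->
  (fun k => complex.Im (z k)) @ \oo --> b ->
  normc (z k - (a +i* b)%C) @[k --> \oo] --> (0 : R).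
Proof.
move=> za zb.
apply: (@squeeze_cvgr _ _ _ _ (fun=> 0)
   (fun k => `|a - complex.Re (z k)| + `|b - complex.Im (z k)|)).
- near=> k; rewrite normc_ge0 (le_trans (normc_le_ReIm _))//.
  by case: (z k) => c d /=; rewrite distrC [`|d - b|]distrC.
- exact: cvg_cst.
- rewrite -[0]addr0; apply: cvgD.
  + by rewrite -(normr0 R) -(subrr a); apply: cvg_norm; apply: cvgB => //; exact: cvg_cst.
  + by rewrite -(normr0 R) -(subrr b); apply: cvg_norm; apply: cvgB => //; exact: cvg_cst.
Unshelve. all: by end_near. Qed.

(** Each entry of the series is dominated, in its real and its imaginary part, by
    the series of exp (nrm X); this is how the limit in mexp is known to exist. *)
Lemma pexp_mlim n (X : 'M[C]_n) : mlim (pexp X) (mexp X).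
Proof.
suff [L cL] : exists L, mlim (pexp X) L by rewrite /mexp (mlim_lim cL).
pose re i j k := complex.Re (((k`!%:R : C)^-1 *: X ^+ k) i j).
pose im i j k := complex.Im (((k`!%:R : C)^-1 *: X ^+ k) i j).
have ub i j k : normc (((k`!%:R : C)^-1 *: X ^+ k) i j) <=
    n.+1%:R * exp_coeff (nrm X) k.
  exact: le_trans (nrm_entry _ _ _) (nrm_exp_term _ _).
have cre i j : cvgn (series (re i j)).
  apply: series_dominated_cvg (is_cvg_series_exp_coeff (nrm X)) => k.
  exact: le_trans (Re_le_normc _) (ub i j k).
have cim i j : cvgn (series (im i j)).
  apply: series_dominated_cvg (is_cvg_series_exp_coeff (nrm X)) => k.
  exact: le_trans (Im_le_normc _) (ub i j k).
exists (\matrix_(i, j) (limn (series (re i j)) +i* limn (series (im i j)))%C).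
rewrite /mlim /nrm.
apply: cvg_sum0 => i; apply: cvg_sum0 => j.
under eq_fun do rewrite !mxE.
apply: cvg_complex.
  under eq_fun do rewrite /pexp /series /= summxE Re_sum.
  exact: cre.
under eq_fun do rewrite /pexp /series /= summxE Im_sum.
exact: cim.
Qed.

End Exponential.

Local Notation ctr X := (X ^t* )%sesqui.

Section ConjugateTranspose.
Variable R : realType.
Local Notation C := R[i].

Lemma ctrD m n (X Y : 'M[C]_(m, n)) : ctr (X + Y) = ctr X + ctr Y.
Proof. by rewrite linearD /= map_mxD. Qed.

Lemma ctrN m n (X : 'M[C]_(m, n)) : ctr (- X) = - ctr X.
Proof. by rewrite linearN /= map_mxN. Qed.

Lemma ctrB m n (X Y : 'M[C]_(m, n)) : ctr (X - Y) = ctr X - ctr Y.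
Proof. by rewrite ctrD ctrN. Qed.

Lemma ctrZ m n (c : C) (X : 'M[C]_(m, n)) : ctr (c *: X) = c^* *: ctr X.
Proof. by rewrite linearZ /= map_mxZ. Qed.

Lemma ctr0 m n : ctr (0 : 'M[C]_(m, n)) = 0.
Proof. by rewrite trmx0 map_mx0. Qed.

Lemma ctrM m n p (X : 'M[C]_(m, n)) (Y : 'M[C]_(n, p)) :
  ctr (X *m Y) = ctr Y *m ctr X.
Proof. by rewrite trmx_mul map_mxM. Qed.

Lemma ctr1 n : ctr (1%:M : 'M[C]_n) = 1%:M.
Proof. by rewrite trmx1 map_mx1. Qed.

Lemma ctrX n (X : 'M[C]_n) k : ctr (X ^+ k) = (ctr X) ^+ k.
Proof.
elim: k => [|k IH]; first by rewrite !expr0 ctr1.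
by rewrite exprS exprSr -!mulmxE ctrM IH.
Qed.

Lemma ctr_inv n (X : 'M[C]_n) : ctr (invmx X) = invmx (ctr X).
Proof. by rewrite trmx_inv map_invmx. Qed.

End ConjugateTranspose.

Section ExponentialLaw.
Variable R : realType.
Import Normc.
Local Notation C := R[i].

(** A Lipschitz map that matches the partial sums matches the limits. *)
Lemma mexp_morph n p (f : 'M[C]_n -> 'M[C]_p) (K : R) X Y :
  (forall A B, nrm (f A - f B) <= K * nrm (A - B)) ->
  (forall k, f (pexp X k) = pexp Y k) -> f (mexp X) = mexp Y.
Proof.
move=> fK fE; apply: (mlim_unique (mlim_lip fK (pexp_mlim X))).
by rewrite (_ : f \o _ = pexp Y)//; [exact: pexp_mlim|exact/funext].
Qed.

Lemma mexp_linear n p (f : {linear 'M[C]_n -> 'M[C]_p}) X Y :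
  (forall k, f (X ^+ k) = Y ^+ k) -> f (mexp X) = mexp Y.
Proof.
move=> fX; have [K _ fK] := nrm_linear_bounded f.
apply: (@mexp_morph _ _ _ K) => [A B|k]; first by rewrite -linearB.
by rewrite linear_sum; apply: eq_bigr => i _; rewrite linearZ /= fX.
Qed.

Lemma mexp0 n : mexp (0 : 'M[C]_n) = 1%:M.
Proof.
apply: (mlim_unique (pexp_mlim 0)); apply/mlimP => e e0.
exists 1%N => // -[//|k] _; rewrite /pexp /series /= big_nat_recl// big1.
  by rewrite addr0 expr0 fact0 invr1 scale1r subrr nrm0.
by move=> i _; rewrite exprS mul0r scaler0.
Qed.

Lemma mexp_conj n (g X : 'M[C]_n) : g \in unitmx ->
  mexp (g *m X *m invmx g) = g *m mexp X *m invmx g.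
Proof.
move=> gu; pose f := [the {linear _ -> _} of mulmxr (invmx g) \o mulmx g].
rewrite -[RHS]/(f (mexp X)); apply/esym/mexp_linear => k /=.
elim: k => [|k IH]; first by rewrite !expr0 mulmx1 mulmxV.
rewrite exprS (exprS (_ *m _)) -IH -!mulmxE !mulmxA.
by rewrite (mulmxKV gu).
Qed.

Lemma mexp_ctr n (X : 'M[C]_n) : ctr (mexp X) = mexp (ctr X).
Proof.
apply: (@mexp_morph _ _ (fun A => ctr A) 1) => [A B|k].
  by rewrite mul1r -ctrB nrm_ctr.
rewrite /pexp /series /=.
rewrite (big_morph (fun A : 'M[C]_n => ctr A) (@ctrD _ _ _) (ctr0 _ _ _)).
by apply: eq_bigr => i _; rewrite ctrZ ctrX; congr (_ *: _); rewrite fmorphV rmorph_nat.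
Qed.

(** The Cauchy product reindexed: summing along the diagonals i + j = m < N is
    summing over the triangle i + j < N. *)
Lemma triangle_sum (V : zmodType) (F : nat -> nat -> V) N :
  \sum_(m < N) \sum_(i < m.+1) F i (m - i)%N =
  \sum_(i < N) \sum_(j < N | (i + j < N)%N) F i j.
Proof.
transitivity (\sum_(m < N) \sum_(i < N | (i <= m)%N) F i (m - i)%N).
  apply: eq_bigr => m _.
  rewrite -(big_mkord xpredT (fun i => F i (m - i)%N)).
  rewrite (big_nat_widen 0 m.+1 N) ?ltn_ord//.
  by rewrite big_mkord.
rewrite (exchange_big_dep xpredT)//=; apply: eq_bigr => i _.
rewrite -(big_mkord (fun m => i <= m)%N (fun m => F i (m - i)%N)).
rewrite -(big_mkord (fun j => i + j < N)%N (fun j => F i j)).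
have iN := ltnW (ltn_ord i).
rewrite (big_cat_nat (leq0n i) iN)//= big_nat_cond big_pred0 ?add0r; last first.
  by move=> m; case: leqP => //=; rewrite andbC; case: ltnP.
rewrite -{1}[i : nat]add0n big_addn.
rewrite [RHS](big_cat_nat (leq0n (N - i)) (leq_subr i N))/=.
rewrite [X in _ = _ + X]big_nat_cond [X in _ = _ + X]big_pred0 ?addr0; last first.
  move=> m; apply/negP => /andP[/andP[]]; rewrite leq_subLR => h1 _.
  by rewrite ltnNge h1.
rewrite big_nat_cond [RHS]big_nat_cond; apply: eq_big => m.
  by rewrite leq_addl andbT /= ltn_subRL andbb.
by rewrite addnK.
Qed.

Lemma mlimM m n p (M : nat -> 'M[C]_(m, n)) (N : nat -> 'M[C]_(n, p)) L L' :
  mlim M L -> mlim N L' -> mlim (fun k => M k *m N k) (L *m L').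
Proof.
move=> cM cN.
pose e k := (nrm (M k - L) + nrm L) * nrm (N k - L') + nrm (M k - L) * nrm L'.
apply: (@mlim_le _ _ _ _ _ e) => [k|].
  rewrite (_ : _ - _ = M k *m (N k - L') + (M k - L) *m L'); last first.
    by rewrite mulmxBr mulmxBl addrA subrK.
  apply: le_trans (nrmD _ _) _; apply: lerD; last exact: nrmM.
  apply: le_trans (nrmM _ _) _; apply: ler_wpM2r; first exact: nrm_ge0.
  by apply: le_trans (nrmD _ _); rewrite subrK.
rewrite (_ : 0 = (0 + nrm L) * 0 + 0 * nrm L' :> R); last by rewrite mulr0 mul0r add0r.
by apply: cvgD; apply: cvgM => //; [apply: cvgD => //|]; exact: cvg_cst.
Qed.

Lemma inv_fact_bin (F : numFieldType) m i : (i <= m)%N ->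
  m`!%:R^-1 * 'C(m, i)%:R = (m - i)`!%:R^-1 * i`!%:R^-1 :> F.
Proof.
move=> le_im; rewrite -[in RHS]invfM.
have fN0 k : (k`!%:R : F) != 0 by rewrite pnatr_eq0 -lt0n fact_gt0.
apply: (mulfI (fN0 m)); rewrite mulrA mulfV// mul1r.
apply: (mulIf (mulf_neq0 (fN0 (m - i)%N) (fN0 i))).
by rewrite -mulrA mulVf ?mulf_neq0// mulr1 -!natrM [(_ * i`!)%N]mulnC bin_fact.
Qed.

Lemma exp_termD n (X Y : 'M[C]_n) m : GRing.comm X Y ->
  (m`!%:R : C)^-1 *: (X + Y) ^+ m =
  \sum_(i < m.+1) ((m - i)`!%:R^-1 *: X ^+ (m - i)) *m (i`!%:R^-1 *: Y ^+ i).
Proof.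
move=> cXY; rewrite exprDn_comm// scaler_sumr; apply: eq_bigr => -[i/= lt_im] _.
rewrite -scalemxAl -scalemxAr scalerA -[_ *+ 'C(_, _)]scaler_nat scalerA mulmxE.
by rewrite inv_fact_bin.
Qed.

Lemma exp_coeffD (a b : R) m :
  exp_coeff (a + b) m = \sum_(i < m.+1) exp_coeff a (m - i)%N * exp_coeff b i.
Proof.
rewrite exp_coeffE exprDn mulr_sumr; apply: eq_bigr => -[i/= lt_im] _.
rewrite !exp_coeffE mulrACA -[_ *+ 'C(_, _)]mulr_natl [LHS]mulrA.
by rewrite inv_fact_bin.
Qed.

(** The product of two partial sums exceeds the partial sum for X + Y by the terms
    with i + j >= k. These are bounded by the corresponding real terms for nrm X and
    nrm Y, whose sum tends to 0 because exp (a + b) = exp a * exp b for reals. *)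
Lemma mexpD n (X Y : 'M[C]_n) : GRing.comm X Y ->
  mexp (X + Y) = mexp X *m mexp Y.
Proof.
move=> cXY; apply/esym/(mlim_unique (mlimM (pexp_mlim X) (pexp_mlim Y))).
pose a := nrm X; pose b := nrm Y; pose K : R := n.+1%:R * n.+1%:R.
pose e k : R := K * (series (exp_coeff a) k * series (exp_coeff b) k -
                 series (exp_coeff (a + b)) k).
have e0 : e @ \oo --> (0 : R).
  rewrite (_ : 0 = K * (expR a * expR b - expR (a + b))); last first.
    by rewrite expRD subrr mulr0.
  apply: cvgM; first exact: cvg_cst.
  by apply: cvgB; [apply: cvgM|]; exact: is_cvg_series_exp_coeff.
have d0 : mlim (fun k => pexp X k *m pexp Y k - pexp (X + Y) k) 0.
  apply: mlim_le e0 => k; rewrite subr0 {}/e.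
  pose F i j := ((j`!%:R : C)^-1 *: X ^+ j) *m (i`!%:R^-1 *: Y ^+ i).
  pose f i j := exp_coeff a j * exp_coeff b i.
  have splitF (V : zmodType) (G : nat -> nat -> V) : \sum_(i < k) \sum_(j < k) G i j
      - \sum_(i < k) \sum_(j < k | (i + j < k)%N) G i j =
      \sum_(i < k) \sum_(j < k | ~~ (i + j < k)%N) G i j.
    rewrite -sumrB; apply: eq_bigr => i _.
    by rewrite (bigID (fun j : 'I_k => i + j < k)%N)/= addrAC subrr add0r.
  have EF : pexp X k *m pexp Y k = \sum_(i < k) \sum_(j < k) F i j.
    rewrite /pexp /series /= !big_mkord mulmx_sumr; apply: eq_bigr => i _.
    by rewrite mulmx_suml.
  have Ef : series (exp_coeff a) k * series (exp_coeff b) k =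
      \sum_(i < k) \sum_(j < k) f i j.
    rewrite /series /= !big_mkord mulr_sumr; apply: eq_bigr => i _.
    by rewrite mulr_suml.
  have EFs : pexp (X + Y) k = \sum_(i < k) \sum_(j < k | (i + j < k)%N) F i j.
    rewrite -triangle_sum /pexp /series /= big_mkord; apply: eq_bigr => m _.
    exact: exp_termD.
  have Efs : series (exp_coeff (a + b)) k =
      \sum_(i < k) \sum_(j < k | (i + j < k)%N) f i j.
    rewrite -triangle_sum /series /= big_mkord; apply: eq_bigr => m _.
    exact: exp_coeffD.
  rewrite EF Ef EFs Efs.
  rewrite !splitF mulr_sumr (le_trans (nrm_sum _ _ _))// ler_sum// => i _.
  rewrite mulr_sumr (le_trans (nrm_sum _ _ _))// ler_sum// => j _.
  rewrite /F /f (le_trans (nrmM _ _))// mulrACA.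
  by apply: ler_pM; rewrite ?nrm_ge0 ?nrm_exp_term.
apply: (@mlim_le _ _ _ _ _ (fun k => nrm (pexp X k *m pexp Y k - pexp (X + Y) k - 0)
     + nrm (pexp (X + Y) k - mexp (X + Y)))) => [k|].
  by rewrite subr0; exact: nrm_triangle.
rewrite -[0 : R]addr0; apply: cvgD; first exact: d0.
exact: pexp_mlim.
Qed.

Lemma mexpNr n (X : 'M[C]_n) : mexp X *m mexp (- X) = 1%:M.
Proof.
by rewrite -mexpD ?subrr ?mexp0// /GRing.comm mulrN mulNr.
Qed.

Lemma mexp_unit n (X : 'M[C]_n) : mexp X \in unitmx.
Proof. exact: (proj1 (mulmx1_unit (mexpNr X))). Qed.

Lemma invmx_mexp n (X : 'M[C]_n) : invmx (mexp X) = mexp (- X).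
Proof.
by rewrite -[RHS](mulKmx (mexp_unit X)) mexpNr mulmx1.
Qed.

Lemma mexpMn n (X : 'M[C]_n) k : mexp (X *+ k) = mexp X ^+ k.
Proof.
elim: k => [|k IH]; first by rewrite mulr0n mexp0 expr0.
rewrite mulrS mexpD ?IH ?exprS//; exact/commrMn.
Qed.

(** The remainder is quadratic, so exp(tX) has derivative X at t = 0. *)
Lemma mexp_taylor1 n (X : 'M[C]_n) :
  nrm (mexp X - (1%:M + X)) <= n.+1%:R * (nrm X ^+ 2 * expR (nrm X)).
Proof.
apply: (mlim_bound (pexp_mlim X)); exists 2%N => // -[//|[//|k]] _.
rewrite /pexp /series /= !big_nat_recl// expr0 expr1 fact0 factS fact0 !invr1.
rewrite !scale1r.
have dropE (A B S : 'M[C]_n) : A + (B + S) - (A + B) = S.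
  by rewrite opprD addrACA subrr add0r addrAC subrr add0r.
rewrite dropE.
apply: le_trans (nrm_sum _ _ _) _.
apply: (@le_trans _ _ (n.+1%:R * (nrm X ^+ 2 * series (exp_coeff (nrm X)) k))); last first.
  apply: ler_wpM2l => //; apply: ler_wpM2l; first exact: sqr_ge0.
  apply: nondecreasing_cvgn_le; last exact: is_cvg_series_exp_coeff.
  by apply/nondecreasing_series => i _ _; exact: exp_coeff_ge0 (nrm_ge0 _).
rewrite /series /= !mulr_sumr ler_sum// => i _.
apply: le_trans (nrm_exp_term _ _) _; apply: ler_wpM2l => //.
rewrite !exp_coeffE [leRHS]mulrCA -exprD add2n ler_wpM2r ?exprn_ge0 ?nrm_ge0//.
rewrite lef_pV2 ?posrE ?ltr0n ?fact_gt0// ler_nat.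
by rewrite !factS mulnA leq_pmull// muln_gt0.
Qed.

End ExponentialLaw.

(** * One-parameter subgroups and the adjoint action *)

Section OneParameter.
Variable R : realType.
Import Normc.
Local Notation C := R[i].

Lemma mlimD m n (M N : nat -> 'M[C]_(m, n)) L L' :
  mlim M L -> mlim N L' -> mlim (fun k => M k + N k) (L + L').
Proof.
move=> cM cN; apply: (@mlim_le _ _ _ _ _
  (fun k => nrm (M k - L) + nrm (N k - L'))) => [k|].
  by rewrite opprD addrACA nrmD.
by rewrite -[0 : R]addr0; apply: cvgD.
Qed.

Lemma mlim_shift m n (M : nat -> 'M[C]_(m, n)) L :
  mlim M L -> mlim (fun k => M k.+1) L.
Proof. by move=> cM; rewrite /mlim (cvg_shiftS (fun k => nrm (M k - L))). Qed.

Lemma normc_natr k : normc (k%:R : C) = k%:R.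
Proof. by rewrite -(rmorph_nat (real_complex R)) normc_real ger0_norm. Qed.

(** Steps of difference quotients at 0, in complex form for use as scalars. *)
Definition step k : C := (k.+1%:R^-1 : R)%:C%C.

Lemma stepE k : step k = k.+1%:R^-1.
Proof. by rewrite /step fmorphV rmorph_nat. Qed.

Lemma stepK m n k (X : 'M[C]_(m, n)) : k.+1%:R *: (step k *: X) = X.
Proof. by rewrite stepE scalerA mulfV ?scale1r// pnatr_eq0. Qed.

Lemma nrm_step m n k (X : 'M[C]_(m, n)) : nrm (step k *: X) = harmonic k * nrm X.
Proof. by rewrite nrmZ stepE normc_natV. Qed.

Lemma cvg_harmonicM (K : R) : (fun k => harmonic k * K) @ \oo --> (0 : R).
Proof. by rewrite -[0 : R](mul0r K); apply: cvgM; [exact: cvg_harmonic|exact: cvg_cst]. Qed.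

Lemma harmonic_le1 k : harmonic k <= (1 : R).
Proof. by rewrite /= invf_le1 ?ltr0n// ler1n. Qed.

Lemma mexp_step_bound n (X : 'M[C]_n) k :
  nrm (mexp (step k *: X) - (1%:M + step k *: X)) <=
  harmonic k * (harmonic k * (n.+1%:R * (nrm X ^+ 2 * expR (nrm X)))).
Proof.
apply: le_trans (mexp_taylor1 _) _; rewrite nrm_step exprMn.
have h0 : 0 <= (harmonic k : R) by rewrite /= invr_ge0.
rewrite !(mulrCA _ n.+1%:R) ler_wpM2l// !expr2 -!mulrA.
do 4 rewrite ler_wpM2l ?nrm_ge0//.
by rewrite ler_expR -[leRHS]mul1r ler_wpM2r ?nrm_ge0// harmonic_le1.
Qed.

Lemma mexp_deriv0 n (X : 'M[C]_n) :
  mlim (fun k => k.+1%:R *: (mexp (step k *: X) - 1%:M)) X.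
Proof.
apply: mlim_le (cvg_harmonicM (n.+1%:R * (nrm X ^+ 2 * expR (nrm X)))) => k.
rewrite -{2}(stepK k X) -scalerBr -addrA -opprD nrmZ normc_natr.
rewrite mulrC -ler_pdivlMr ?ltr0n// mulrC; exact: mexp_step_bound.
Qed.

Lemma mexp_step_cvg1 n (X : 'M[C]_n) : mlim (fun k => mexp (step k *: X)) 1%:M.
Proof.
pose K := n.+1%:R * (nrm X ^+ 2 * expR (nrm X)).
apply: mlim_le (cvg_harmonicM (K + nrm X)) => k.
rewrite mulrDr -nrm_step.
apply: le_trans (nrm_triangle (1%:M + step k *: X) _ _) _.
rewrite [1%:M + _ - _]addrAC subrr add0r lerD2r (le_trans (mexp_step_bound _ _))//.
rewrite ler_wpM2l//= ?invr_ge0// -[leRHS]mul1r ler_wpM2r ?harmonic_le1//.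
by rewrite !mulr_ge0 ?nrm_ge0 ?expR_ge0.
Qed.

(** Compare derivatives at t = 0. *)
Lemma mexp_inj n (X Y : 'M[C]_n) :
  (forall t : R, mexp (t%:C%C *: X) = mexp (t%:C%C *: Y)) -> X = Y.
Proof.
move=> eXY; apply: (mlim_unique (mexp_deriv0 X)).
rewrite (_ : (fun k => _) = (fun k => k.+1%:R *: (mexp (step k *: Y) - 1%:M))).
  exact: mexp_deriv0.
by apply/funext => k; rewrite eXY.
Qed.

(** Leibniz rule for t |-> exp(tX) Y exp(-tX). *)
Lemma Ad_deriv0 n (X Y : 'M[C]_n) :
  mlim (fun k => k.+1%:R *: (Ad (mexp (step k *: X)) Y - Y)) (lie X Y).
Proof.
have -> : lie X Y = X *m (Y *m 1%:M) + Y *m (- X).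
  by rewrite mulmx1 mulmxN.
rewrite (_ : (fun k => _) = (fun k =>
    (k.+1%:R *: (mexp (step k *: X) - 1%:M)) *m (Y *m mexp (step k *: - X)) +
    Y *m (k.+1%:R *: (mexp (step k *: - X) - 1%:M)))).
  apply: mlimD.
    apply: mlimM (mexp_deriv0 _) _.
    exact: mlimM (mlim_cst _) (mexp_step_cvg1 _).
  exact: mlimM (mlim_cst _) (mexp_deriv0 _).
apply/funext => k; rewrite -scalemxAl -scalemxAr -scalerDr; congr (_ *: _).
rewrite /Ad invmx_mexp scalerN mulmxBl mulmxBr mul1mx mulmx1 !mulmxA.
by rewrite addrA subrK.
Qed.

(** A subspace that contains a curve contains its derivative. *)
Lemma lie_memv n (W : {vspace 'M[C]_n}) (X Y : 'M[C]_n) : Y \in W ->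
  (forall t : R, Ad (mexp (t%:C%C *: X)) Y \in W) -> lie X Y \in W.
Proof.
move=> WY WAd; apply: mlim_memv (Ad_deriv0 X Y) => k.
by rewrite memvZ// memvB//; exact: WAd.
Qed.

(** As operators on matrices, ad X = L - R with L and R the commuting left and right
    multiplications by X, so exp(ad X) = exp(L) exp(-R) = Ad(exp X). *)
Lemma Ad_mexp_series n (X Y : 'M[C]_n) :
  mlim (fun k => \sum_(i < k) (i`!%:R : C)^-1 *: iter i (lie X) Y)
       (Ad (mexp X) Y).
Proof.
pose L : 'M[C]_(n * n) := lin_mulmx X.
pose Rr : 'M[C]_(n * n) := lin_mulmxr (- X).
have mulL Z (A : 'M[C]_n) : mxvec A *m lin_mulmx Z = mxvec (Z *m A).
  by rewrite mul_vec_lin.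
have mulR Z (A : 'M[C]_n) : mxvec A *m lin_mulmxr Z = mxvec (A *m Z).
  by rewrite mul_vec_lin.
have vecP (A B : 'M[C]_(n * n)) :
    (forall Z : 'M[C]_n, mxvec Z *m A = mxvec Z *m B) -> A = B.
  by move=> AB; apply/row_matrixP => i; rewrite !rowE -(vec_mxK (delta_mx 0 i)) AB.
have expL : lin_mulmx (mexp X) = mexp L.
  apply: mexp_linear => k; elim: k => [|k IH].
    by rewrite !expr0; apply: vecP => Z; rewrite mulL mul1mx mulmx1.
  by rewrite exprSr exprS -IH; apply: vecP => Z; rewrite -!mulmxE mulmxA !mulL !mulmxA.
have expR : lin_mulmxr (mexp (- X)) = mexp Rr.
  apply: mexp_linear => k; elim: k => [|k IH].
    by rewrite !expr0; apply: vecP => Z; rewrite mulR !mulmx1.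
  by rewrite exprS exprS -IH; apply: vecP => Z; rewrite -!mulmxE mulmxA !mulR !mulmxA.
have mulLX A : mxvec A *m L = mxvec (X *m A) by exact: mulL.
have mulRX A : mxvec A *m Rr = mxvec (- (A *m X)) by rewrite -mulmxN; exact: mulR.
have AdE : mxvec Y *m mexp (L + Rr) = mxvec (Ad (mexp X) Y).
  rewrite mexpD; first by rewrite -expL -expR mulmxA mulL mulR /Ad invmx_mexp.
  apply: vecP => Z; rewrite -!mulmxE !mulmxA mulLX !mulRX mulLX.
  by rewrite mulmxN mulmxA.
clear expL expR vecP mulL mulR; clearbody L Rr.
have := mlim_linear vec_mx (mlimM (mlim_cst (mxvec Y)) (pexp_mlim (L + Rr))).
rewrite AdE /= mxvecK; congr (mlim _ _); apply/funext => k /=.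
rewrite /pexp /series /= big_mkord mulmx_sumr linear_sum; apply: eq_bigr => i _.
rewrite -scalemxAr linearZ /=; congr (_ *: _); apply: (canLR mxvecK).
elim: (i : nat) => [|j IH]; first by rewrite expr0 mulmx1.
by rewrite exprSr -mulmxE mulmxA IH mulmxDr mulLX mulRX -linearD.
Qed.

(** In the series exp(ad X) Y every term but the first lies in W. *)
Lemma Ad_mexp_sub n (V W : {vspace 'M[C]_n}) X :
  (forall Y, Y \in V -> lie X Y \in W) -> (forall Y, Y \in W -> lie X Y \in W) ->
  forall Y, Y \in V -> Ad (mexp X) Y - Y \in W.
Proof.
move=> XV XW Y VY.
have := mlimD (mlim_shift (Ad_mexp_series X Y)) (mlim_cst (- Y)).
apply: mlim_memv => k; rewrite big_ord_recl fact0 invr1 scale1r addrAC subrr add0r.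
apply: memv_suml => i _; rewrite lift0 memvZ//.
elim: (i : nat) => [|j IH]; first exact: XV.
by rewrite iterS XW.
Qed.

End OneParameter.

(** * The Lie product formula *)

Section Trotter.
Variable R : realType.
Import Normc.
Local Notation C := R[i].

(** The rows of a unitary matrix are unit vectors, so its entries have modulus at
    most 1. *)
Lemma nrm_unitary n (V : 'M[C]_n) : V \is unitarymx -> nrm V <= (n * n)%:R.
Proof.
move=> /unitarymxP VV.
have entry_le1 i j : normc (V i j) <= 1.
  have := congr1 (fun A : 'M[C]_n => A i i) VV.
  rewrite !mxE eqxx (bigD1 j)//= => /(congr1 (@complex.Re R)).
  rewrite ReD Re_sum /= => e1.
  have term k : complex.Re (V i k * (ctr V) k i) = normc (V i k) ^+ 2.
    rewrite !mxE; case: (V i k) => a b; rewrite /= sqr_sqrtr ?addr_ge0 ?sqr_ge0//.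
    by rewrite mulrN opprK !expr2.
  rewrite -[leRHS]sqrtr1 -[leLHS]ger0_norm ?normc_ge0// -sqrtr_sqr ler_wsqrtr//.
  rewrite -[leRHS]e1 term lerDl sumr_ge0// => k _; by rewrite term sqr_ge0.
apply: (@le_trans _ _ (\sum_(i < n) \sum_(j < n) 1)).
  by apply: ler_sum => i _; apply: ler_sum.
by rewrite !sumr_const card_ord -mulrnA.
Qed.

Lemma unitarymxX n (A : 'M[C]_n) k : A \is unitarymx -> A ^+ k \is unitarymx.
Proof.
move=> uA; elim: k => [|k IH].
  by apply/unitarymxP; rewrite expr0 ctr1 mulmx1.
by rewrite exprS; exact: mul_unitarymx uA IH.
Qed.

(** Telescoping A^k - B^k keeps only unitary factors around each A - B; the extra
    factor V makes the induction go through. *)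
Lemma unitary_pow_lip n (A B V : 'M[C]_n) k :
  A \is unitarymx -> B \is unitarymx -> V \is unitarymx ->
  nrm (V *m (A ^+ k - B ^+ k)) <=
  k%:R * ((n * n)%:R * (n * n)%:R * nrm (A - B)).
Proof.
move=> uA uB; elim: k V => [|k IH] V uV.
  by rewrite !expr0 subrr mulmx0 nrm0 mul0r.
have -> : V *m (A ^+ k.+1 - B ^+ k.+1) =
    (V *m A) *m (A ^+ k - B ^+ k) + V *m (A - B) *m B ^+ k.
  by rewrite !exprS !(mulmxBr, mulmxBl) !mulmxA addrA subrK.
apply: le_trans (nrmD _ _) _; rewrite -natr1 mulrDl mul1r.
apply: lerD; first exact: IH (mul_unitarymx uV uA).
apply: le_trans (nrmM _ _) _; rewrite mulrAC.
apply: ler_pM (nrm_ge0 _) (nrm_ge0 _) _ (nrm_unitary (unitarymxX k uB)).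
apply: le_trans (nrmM _ _) _.
exact: ler_wpM2r (nrm_ge0 _) _ _ (nrm_unitary uV).
Qed.

Lemma mexp_unitary n (X : 'M[C]_n) : ctr X = - X -> mexp X \is unitarymx.
Proof. by move=> sX; apply/unitarymxP; rewrite mexp_ctr sX mexpNr. Qed.

Lemma ctr_real n (t : R) (X : 'M[C]_n) : ctr (t%:C%C *: X) = t%:C%C *: ctr X.
Proof. by rewrite ctrZ conj_Creal// ; rewrite complex_real. Qed.

(** Both exp(X/k)exp(Y/k) and exp((X+Y)/k) are unitary, so taking k-th powers
    amplifies their discrepancy, which is o(1/k), by at most a multiple of k. *)
Lemma trotter n (X Y : 'M[C]_n) : ctr X = - X -> ctr Y = - Y ->
  mlim (fun k => (mexp (step R k *: X) *m mexp (step R k *: Y)) ^+ k.+1)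
       (mexp (X + Y)).
Proof.
move=> sX sY.
pose A k := mexp (step R k *: X) *m mexp (step R k *: Y).
pose B k := mexp (step R k *: (X + Y)).
have sk (Z : 'M[C]_n) k : ctr Z = - Z -> ctr (step R k *: Z) = - (step R k *: Z).
  by move=> sZ; rewrite ctr_real sZ scalerN.
have uA k : A k \is unitarymx by rewrite mul_unitarymx ?mexp_unitary ?sk.
have uB k : B k \is unitarymx by rewrite mexp_unitary ?sk// ctrD sX sY opprD.
have powB k : B k ^+ k.+1 = mexp (X + Y).
  by rewrite -mexpMn -scaler_nat stepK.
(* Both products have derivative X + Y at 0, so the difference is o(1/k). *)
have cAB : mlim (fun k => k.+1%:R *: (A k - B k)) 0.
  have -> : 0 = X *m 1%:M + Y - (X + Y) by rewrite mulmx1 subrr.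
  have := mlimD (mlimD (mlimM (mexp_deriv0 X) (mexp_step_cvg1 Y)) (mexp_deriv0 Y))
                (mlim_linear -%R (mexp_deriv0 (X + Y))).
  congr (mlim _ _); apply/funext => k /=.
  rewrite -scalemxAl -scalerDr -scalerN -scalerDr; congr (_ *: _).
  by rewrite mulmxBl mul1mx addrA subrK opprB addrA subrK.
pose K : R := (n * n)%:R * (n * n)%:R.
apply: (@mlim_le _ _ _ _ _ (fun k => K * nrm (k.+1%:R *: (A k - B k) - 0))) => [k|].
  rewrite -(powB k) -[X in nrm X]mul1mx subr0 nrmZ normc_natr mulrCA.
  apply: unitary_pow_lip (uA k) (uB k) _.
  by apply/unitarymxP; rewrite ctr1 mulmx1.
by rewrite -(mulr0 K); apply: cvgM => //; exact: cvg_cst.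
Qed.

(** exp(sX) - exp(tX) = exp(tX) (exp((s-t)X) - 1), and the last factor is small. *)
Lemma mexp_curve_continuous n (X : 'M[C]_n) :
  continuous (fun t : R => mexp (t%:C%C *: X)).
Proof.
move=> t; apply: nrm_cvg.
pose e (s : R) := nrm (mexp (t%:C%C *: X)) *
   (n.+1%:R * ((`|s - t| * nrm X) ^+ 2 * expR (`|s - t| * nrm X)) + `|s - t| * nrm X).
have d0 : (fun s : R => s - t) s @[s --> t] --> t - t.
  by apply: cvgB; [exact: cvg_id|exact: cvg_cst].
have n0 : `|s - t| @[s --> t] --> `|t - t| by exact: cvg_norm.
have a0 : `|s - t| * nrm X @[s --> t] --> (0 : R).
  have : `|s - t| * nrm X @[s --> t] --> `|t - t| * nrm X.
    by apply: cvgM n0 _; exact: cvg_cst.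
  by rewrite subrr normr0 mul0r.
have E0 : expR (`|s - t| * nrm X) @[s --> t] --> (1 : R).
  by rewrite -expR0; exact: (continuous_cvg _ (@continuous_expR R 0) a0).
have e0 : e s @[s --> t] --> (0 : R).
  have : e s @[s --> t] -->
      nrm (mexp (t%:C%C *: X)) * (n.+1%:R * ((0 * 0) * 1) + 0).
    apply: cvgM; first exact: cvg_cst.
    apply: (cvgD _ a0); apply: cvgM; first exact: cvg_cst.
    by apply: cvgM E0; exact: (cvgM a0 a0).
  by rewrite mulr1 !mulr0 addr0 mulr0.
apply: (squeeze_cvgr _ (cvg_cst 0) e0); apply: nearW => s.
rewrite nrm_ge0 /= /e.
have -> : mexp (s%:C%C *: X) - mexp (t%:C%C *: X) =
    mexp (t%:C%C *: X) *m (mexp ((s - t)%:C%C *: X) - 1%:M).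
  have eX : s%:C%C *: X = t%:C%C *: X + (s - t)%:C%C *: X.
    by rewrite -scalerDl -rmorphD /= addrCA subrr addr0.
  have cX : GRing.comm (t%:C%C *: X) ((s - t)%:C%C *: X).
    by rewrite /GRing.comm -!mulmxE -!scalemxAl -!scalemxAr scalerA mulrC -scalerA.
  by rewrite mulmxBr mulmx1 eX (mexpD cX).
apply: le_trans (nrmM _ _) _; rewrite ler_wpM2l ?nrm_ge0//.
have nX : `|s - t| * nrm X = nrm ((s - t)%:C%C *: X) by rewrite nrmZ normc_real.
rewrite nX; apply: le_trans (nrm_triangle (1%:M + (s - t)%:C%C *: X) _ _) _.
by rewrite lerD ?mexp_taylor1// addrAC subrr add0r.
Qed.

End Trotter.

(** * Spans, traces and brackets *)

Section VspanInd.
Variables (K : fieldType) (V : vectType K).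

Lemma mem_vspan (S : set V) x : S x -> x \in vspan S.
Proof. by case: (vspanP S) => + _; exact. Qed.

(** A finite subset of S whose span has maximal dimension already spans, so every
    element of the span is a finite combination of elements of S. *)
Lemma vspan_ind (S : set V) (Q : V -> Prop) :
  Q 0 -> (forall x y, Q x -> Q y -> Q (x + y)) ->
  (forall a x, Q x -> Q (a *: x)) -> (forall x, S x -> Q x) ->
  forall x, x \in vspan S -> Q x.
Proof.
move=> Q0 QD QZ QS.
pose P d := `[< exists2 s : seq V, {in s, forall x, S x} & \dim (span s) = d >].
have exP : exists d, P d by exists (\dim (span ([::] : seq V))); apply/asboolP; exists [::].
have ubP d : P d -> (d <= \dim (fullv : {vspace V}))%N.
  by move=> /asboolP[s _ <-]; exact: dimvS (subvf _).
case: (ex_maxnP exP ubP) => d /asboolP[s sS ds] dmax.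
have Ss x : S x -> x \in span s.
  move=> Sx; have : (\dim (span (x :: s)) <= \dim (span s))%N.
    rewrite ds; apply: dmax; apply/asboolP; exists (x :: s) => //.
    by move=> y; rewrite inE => /orP[/eqP->//|/sS].
  move=> le_d; have /eqP -> : (span s == span (x :: s))%VS.
    by rewrite eqEdim le_d andbT; apply: sub_span => y ys; rewrite inE ys orbT.
  by rewrite memv_span// mem_head.
move=> x; case: (vspanP S) => _ /(_ _ Ss) /subvP /[apply].
move=> /(coord_span (X := in_tuple s)) ->.
elim/big_ind: _ => // i _; apply: QZ; apply: QS; apply: sS.
by rewrite mem_nth.
Qed.

End VspanInd.

Section Trace.
Variables (K : fieldType) (V : vectType K).
Implicit Types (W : {vspace V}) (f g : 'End(V)).

(** For f preserving W this is the trace of the restriction of f to W. *)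
Definition trv W f : K := \sum_(j < \dim W) coord (vbasis W) j (f (vbasis W)`_j).

Lemma trv_eq W f g : {in W, f =1 g} -> trv W f = trv W g.
Proof.
move=> fg; apply: eq_bigr => j _; rewrite fg//.
by rewrite vbasis_mem// mem_nth// size_tuple.
Qed.

Lemma trvD W f g : trv W (f + g) = trv W f + trv W g.
Proof. by rewrite -big_split; apply: eq_bigr => j _; rewrite add_lfunE linearD. Qed.

Lemma trvZ W a f : trv W (a *: f) = a * trv W f.
Proof. by rewrite mulr_sumr; apply: eq_bigr => j _; rewrite scale_lfunE linearZ. Qed.

(** Expanding both sides on the basis gives the same double sum. *)
Lemma trvC W f g : {in W, forall x, f x \in W} -> {in W, forall x, g x \in W} ->
  trv W (f \o g)%VF = trv W (g \o f)%VF.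
Proof.
move=> fW gW; pose e := vbasis W.
have eW j : (j < \dim W)%N -> e`_j \in W.
  by move=> jW; rewrite vbasis_mem// mem_nth// size_tuple.
have expand (h k : 'End(V)) : {in W, forall x, h x \in W} ->
  trv W (k \o h)%VF =
  \sum_(j < \dim W) \sum_(i < \dim W) coord e i (h e`_j) * coord e j (k e`_i).
  move=> hW; apply: eq_bigr => j _; rewrite comp_lfunE.
  rewrite {1}(coord_vbasis (hW _ (eW j (ltn_ord j)))) linear_sum linear_sum.
  by apply: eq_bigr => i _; rewrite !linearZ.
rewrite (expand g f gW) (expand f g fW) exchange_big /=.
by do 2 apply: eq_bigr => ? _; rewrite mulrC.
Qed.

End Trace.

Section KillingForm.
Variables (R : realType) (n : nat) (U : set 'M[R[i]]_n).
Local Notation M := 'M[R[i]]_n.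
Local Notation g := (fg U).

(** lie X as a bundled endomorphism, so that traces apply to it. *)
Definition ad (X : M) : 'End(M) := linfun (mulmx X) - linfun (mulmxr X).

Lemma adE X Y : ad X Y = lie X Y.
Proof. by rewrite /ad add_lfunE opp_lfunE !lfunE. Qed.

Lemma lieDr (X Y Z : M) : lie X (Y + Z) = lie X Y + lie X Z.
Proof. by rewrite -!adE linearD. Qed.

Lemma lieZr (X Y : M) (c : R[i]) : lie X (c *: Y) = c *: lie X Y.
Proof. by rewrite -!adE linearZ. Qed.

Lemma lieC (X Y : M) : lie X Y = - lie Y X.
Proof. by rewrite /lie opprB. Qed.

Lemma lieDl (X Y Z : M) : lie (X + Y) Z = lie X Z + lie Y Z.
Proof. by rewrite lieC lieDr opprD -!lieC. Qed.

Lemma lieZl (X Y : M) (c : R[i]) : lie (c *: X) Y = c *: lie X Y.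
Proof. by rewrite lieC lieZr -scalerN -lieC. Qed.

Lemma lie0l (X : M) : lie 0 X = 0.
Proof. by rewrite /lie mul0mx mulmx0 subrr. Qed.

Lemma lie0r (X : M) : lie X 0 = 0.
Proof. by rewrite lieC lie0l oppr0. Qed.

Lemma lieNr (X Y : M) : lie X (- Y) = - lie X Y.
Proof. by rewrite -scaleN1r lieZr scaleN1r. Qed.

Lemma lieNl (X Y : M) : lie (- X) Y = - lie X Y.
Proof. by rewrite -scaleN1r lieZl scaleN1r. Qed.

Lemma lie_jacobi (X Y Z : M) : lie X (lie Y Z) = lie (lie X Y) Z + lie Y (lie X Z).
Proof.
rewrite /lie !(mulmxBr, mulmxBl) !mulmxA.
set a := X *m Y *m Z; set b := X *m Z *m Y; set c := Y *m Z *m X.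
set d := Z *m Y *m X; set e := Y *m X *m Z; set f := Z *m X *m Y.
clearbody a b c d e f.
by apply/matrixP => i j; rewrite !mxE; ring.
Qed.

Lemma killingE X Y : killing U X Y = trv g (ad X \o ad Y)%VF.
Proof. by apply: eq_bigr => j _; rewrite comp_lfunE !adE. Qed.

End KillingForm.

Local Opaque mexp.

(** * The Lie algebra of a compact unitary group and its complexification *)

Section UnitaryGroup.
Variables (R : realType) (n : nat) (U : set 'M[R[i]]_n).
Hypothesis hU : compact_unitary_group U.
Local Notation M := 'M[R[i]]_n.
Local Notation C := R[i].
Local Notation g := (fg U).
Local Notation u := (fu U).
Local Notation killing := (killing U).
Implicit Types X Y Z : M.

Let Uunit X : U X -> X \in unitmx.
Proof. by case: hU => -[+ _ _ _] _ _; exact. Qed.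
Let Umul X Y : U X -> U Y -> U (X *m Y).
Proof. by case: hU => -[_ _ + _] _ _; exact. Qed.
Let Uinv X : U X -> U (invmx X).
Proof. by case: hU => -[_ _ _ +] _ _; exact. Qed.
Let U1 : U 1%:M.
Proof. by case: hU => -[_ + _ _]. Qed.
Let Uunitary X : U X -> X \is unitarymx.
Proof. by case: hU => _ + _; exact. Qed.
Let Ucompact : compact U. Proof. by case: hU. Qed.

(** exp(tX) is unitary, so its conjugate transpose is also its inverse exp(-tX);
    compare derivatives at 0. *)
Lemma fu_ctr X : u X -> ctr X = - X.
Proof.
move=> uX; apply: mexp_inj => t.
rewrite -ctr_real -mexp_ctr -invmx_unitary ?invmx_mexp ?scalerN//.
exact/Uunitary/uX.
Qed.

Lemma fu0 : u 0.
Proof. by move=> t; rewrite scaler0 mexp0. Qed.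

Lemma fuZ (t : R) X : u X -> u (t%:C%C *: X).
Proof. by move=> uX s; rewrite scalerA -rmorphM; exact: uX. Qed.

Lemma fuN X : u X -> u (- X).
Proof. by move=> uX; rewrite -scaleN1r -(rmorphN1 (real_complex R)); exact: fuZ. Qed.

(** The Lie product formula expresses exp(t(X + Y)) as a limit of elements of U, and
    U is closed. *)
Lemma fuD X Y : u X -> u Y -> u (X + Y).
Proof.
move=> uX uY t.
have skt Z : u Z -> ctr (t%:C%C *: Z) = - (t%:C%C *: Z).
  by move=> uZ; exact: fu_ctr (fuZ _ uZ).
rewrite scalerDr; have := trotter (skt _ uX) (skt _ uY).
apply: mlim_compact => // k.
have Ak : U (mexp (step R k *: (t%:C%C *: X)) *m mexp (step R k *: (t%:C%C *: Y))).
  by apply: Umul; apply: fuZ.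
by elim: k.+1 => [|m IH]; [rewrite expr0|rewrite exprS; exact: Umul].
Qed.

Lemma fuB X Y : u X -> u Y -> u (X - Y).
Proof. by move=> uX uY; exact: fuD uX (fuN uY). Qed.

Lemma fu_of_mexp X : (forall t : R, U (mexp (t%:C%C *: X))) -> u X.
Proof. exact. Qed.

Lemma fu_mexp X (t : R) : u X -> U (mexp (t%:C%C *: X)).
Proof. exact. Qed.

Lemma fu_Ad (h X : M) : U h -> u X -> u (Ad h X).
Proof.
move=> Uh uX t; rewrite (_ : _ *: _ = h *m (t%:C%C *: X) *m invmx h); last first.
  by rewrite /Ad -scalemxAr -scalemxAl.
rewrite mexp_conj ?Uunit//.
by apply: Umul; [apply: Umul Uh (uX t)|exact: Uinv].
Qed.

Local Opaque fu.

Lemma Ad_scale (h X : M) (c : C) : Ad h (c *: X) = c *: Ad h X.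
Proof. by rewrite /Ad -scalemxAr -scalemxAl. Qed.

Lemma Ad_add (h X Y : M) : Ad h (X + Y) = Ad h X + Ad h Y.
Proof. by rewrite /Ad mulmxDr mulmxDl. Qed.

Lemma Ad_opp (h X : M) : Ad h (- X) = - Ad h X.
Proof. by rewrite -scaleN1r Ad_scale scaleN1r. Qed.

Lemma fu_fg X : u X -> X \in g. Proof. exact: (@mem_vspan _ _ (fu U)). Qed.

Lemma complex_ReIm (z : C) :
  z = (complex.Re z)%:C%C + 'i * (complex.Im z)%:C%C.
Proof. by rewrite {1}[z]complexE complexiE. Qed.

Lemma i2E : 'i * 'i = -1 :> C.
Proof. by rewrite -expr2 sqrCi. Qed.

(** u is a real subspace, so u + iu is a complex one. *)
Lemma fgP X : X \in g -> exists A B, [/\ u A, u B & X = A + 'i *: B].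
Proof.
move: X; apply: vspan_ind => [|X Y [A [B [uA uB ->]]] [A' [B' [uA' uB' ->]]]||].
- by exists 0, 0; split; [exact: fu0|exact: fu0|rewrite scaler0 addr0].
- exists (A + A'), (B + B'); split; [exact: fuD|exact: fuD|].
  by rewrite scalerDr addrACA.
- move=> z X [A [B [uA uB ->]]].
  pose a := (complex.Re z)%:C%C; pose b := (complex.Im z)%:C%C.
  exists (a *: A - b *: B), (b *: A + a *: B).
  split; [by apply: fuB; exact: fuZ|by apply: fuD; exact: fuZ|].
  rewrite (complex_ReIm z) -/a -/b.
  by apply/matrixP => j k; rewrite !mxE; ring: i2E.
- by move=> X uX; exists X, 0; split; [exact: uX|exact: fu0|rewrite scaler0 addr0].
Qed.

Lemma fg_ctr X : X \in g -> ctr X \in g.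
Proof.
move=> /fgP[A [B [uA uB ->]]]; rewrite ctrD ctrZ !fu_ctr//.
by rewrite memvD ?memvZ// ?memvN fu_fg.
Qed.

Lemma eq_opp0 X : X = - X -> X = 0.
Proof.
move=> eX; have : 2%:R *: X = 0 :> M by rewrite scaler_nat mulr2n {1}eX addNr.
by move/eqP; rewrite scaler_eq0 pnatr_eq0 => /eqP.
Qed.

(** u is the skew-Hermitian part of g = u + iu: in X = A + iB the summand iB is
    Hermitian. *)
Lemma fu_of_skew X : X \in g -> ctr X = - X -> u X.
Proof.
move=> /fgP[A [B [uA uB ->]]]; rewrite ctrD ctrZ (fu_ctr uA) (fu_ctr uB) conjCi.
rewrite scaleNr scalerN opprK opprD => /addrI /eq_opp0 ->.
by rewrite addr0.
Qed.

Lemma fg_Ad_U h X : U h -> X \in g -> Ad h X \in g.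
Proof.
move=> Uh /fgP[A [B [uA uB ->]]].
have gA Z : u Z -> Ad h Z \in g by move=> uZ; exact: fu_fg (fu_Ad Uh uZ).
by rewrite Ad_add Ad_scale; exact: memvD (gA _ uA) (memvZ _ (gA _ uB)).
Qed.

(** Ad(exp tX) preserves the span of u, and ad X is its derivative. *)
Lemma fg_lie X Y : X \in g -> Y \in g -> lie X Y \in g.
Proof.
move=> /fgP[A [B [uA uB ->]]] gY.
have lie_u Z : u Z -> lie Z Y \in g.
  by move=> uZ; apply: lie_memv => // t; apply: fg_Ad_U => //; exact: fu_mexp.
by rewrite lieDl lieZl memvD ?memvZ ?lie_u.
Qed.

(** Both directions are recorded so that such matrices form a group, as the
    definition of G requires. *)
Definition preserves_fg (h : M) :=
  [/\ h \in unitmx, forall X, X \in g -> Ad h X \in g &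
      forall X, X \in g -> Ad (invmx h) X \in g].

Lemma invmxM (h k : M) : h \in unitmx -> k \in unitmx ->
  invmx (h *m k) = invmx k *m invmx h.
Proof.
move=> hu ku; have hku : h *m k \in unitmx by rewrite unitmx_mul hu.
by rewrite -[RHS](mulKmx hku) -mulmxA (mulKVmx ku) mulmxV// mulmx1.
Qed.

Lemma AdM (h k X : M) : h \in unitmx -> k \in unitmx ->
  Ad (h *m k) X = Ad h (Ad k X).
Proof. by move=> hu ku; rewrite /Ad invmxM ?mulmxA. Qed.

Lemma AdK (h X : M) : h \in unitmx -> Ad (invmx h) (Ad h X) = X.
Proof.
by move=> hu; rewrite -AdM ?unitmx_inv// mulVmx// /Ad mul1mx invmx1 mulmx1.
Qed.

Lemma AdVK (h X : M) : h \in unitmx -> Ad h (Ad (invmx h) X) = X.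
Proof.
by move=> hu; rewrite -AdM ?unitmx_inv// mulmxV// /Ad mul1mx invmx1 mulmx1.
Qed.

(** g is a Lie algebra, hence stable under exp(ad X). *)
Lemma preserves_fg_mexp X : X \in g -> preserves_fg (mexp X).
Proof.
have AdX Z : Z \in g -> forall Y, Y \in g -> Ad (mexp Z) Y \in g.
  move=> gZ Y gY; rewrite -[Ad _ Y](subrK Y) memvD//.
  by apply: (@Ad_mexp_sub _ _ g) => // W gW; exact: fg_lie.
move=> gX; split; [exact: mexp_unit|exact: AdX|].
by rewrite invmx_mexp; apply: AdX; rewrite memvN.
Qed.

Lemma grpG_preserves h : grpG U h -> preserves_fg h.
Proof.
apply; last exact: preserves_fg_mexp; split.
- by move=> k [].
- split; [exact: unitmx1|move=> X|move=> X]; by rewrite ?invmx1 /Ad invmx1 mul1mx mulmx1.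
- move=> k l [ku gk gk'] [lu gl gl']; split.
  + by rewrite unitmx_mul ku.
  + by move=> X gX; rewrite AdM//; apply/gk/gl.
  + by move=> X gX; rewrite invmxM// AdM ?unitmx_inv//; apply/gl'/gk'.
- by move=> k [ku gk gk']; split; rewrite ?unitmx_inv ?invmxK.
Qed.

Lemma U_preserves h : U h -> preserves_fg h.
Proof.
move=> Uh; split; first exact: Uunit.
  by move=> X; exact: fg_Ad_U.
by move=> X; apply: fg_Ad_U; exact: Uinv.
Qed.

Lemma grpG_subgroup : mx_subgroup (grpG U).
Proof.
split.
- by move=> h /grpG_preserves[].
- by move=> H [].
- by move=> h k Gh Gk H HH HX; case: (HH) => _ _ + _; apply; [exact: Gh|exact: Gk].
- by move=> h Gh H HH HX; case: (HH) => _ _ _; apply; exact: Gh.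
Qed.

Lemma grpG_mexp X : X \in g -> grpG U (mexp X).
Proof. by move=> gX H _; exact. Qed.

Lemma grpG_cstar_inv h : grpG U h -> grpG U (cstar_inv h).
Proof.
have [_ G1 GM GV] := grpG_subgroup.
pose H := [set h : M | h \in unitmx /\ grpG U (cstar_inv h)].
suff HG : grpG U `<=` H by move=> /HG[].
move=> {}h; apply; last first.
  move=> X gX; split; first exact: mexp_unit.
  by rewrite /cstar_inv mexp_ctr invmx_mexp; apply: grpG_mexp; rewrite memvN fg_ctr.
split.
- by move=> k [].
- by split; [exact: unitmx1|rewrite /cstar_inv ctr1 invmx1].
- move=> k l [ku Gk] [lu Gl]; split; first by rewrite unitmx_mul ku.
  rewrite /cstar_inv ctrM invmxM ?unitmxE ?det_map_mx ?det_tr ?fmorph_unit//.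
  exact: GM.
- move=> k [ku Gk]; split; first by rewrite unitmx_inv.
  by rewrite /cstar_inv ctr_inv; exact: GV.
Qed.

End UnitaryGroup.

Local Opaque fu.

(** * Invariance of the Killing form *)

Lemma mexp_Ad (R : realType) n (h X : 'M[R[i]]_n) : h \in unitmx ->
  mexp (Ad h X) = Ad h (mexp X).
Proof. exact: mexp_conj. Qed.

Section KillingInvariance.
Variables (R : realType) (n : nat) (U : set 'M[R[i]]_n).
Hypothesis hU : compact_unitary_group U.
Local Notation M := 'M[R[i]]_n.
Local Notation C := R[i].
Local Notation g := (fg U).
Local Notation u := (fu U).
Local Notation killing := (killing U).
Implicit Types X Y Z : M.

Lemma killingDl X Y Z : killing (X + Y) Z = killing X Z + killing Y Z.
Proof. by rewrite -big_split; apply: eq_bigr => j _; rewrite lieDl linearD. Qed.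

Lemma killingZl (c : C) X Y : killing (c *: X) Y = c * killing X Y.
Proof. by rewrite mulr_sumr; apply: eq_bigr => j _; rewrite lieZl linearZ. Qed.

Lemma killingNl X Y : killing (- X) Y = - killing X Y.
Proof. by rewrite -scaleN1r killingZl mulN1r. Qed.

Lemma killingBl X Y Z : killing (X - Y) Z = killing X Z - killing Y Z.
Proof. by rewrite killingDl killingNl. Qed.

Lemma killingDr X Y Z : killing X (Y + Z) = killing X Y + killing X Z.
Proof.
by rewrite -big_split; apply: eq_bigr => j _; rewrite lieDl lieDr linearD.
Qed.

Lemma killingZr (c : C) X Y : killing X (c *: Y) = c * killing X Y.
Proof.
by rewrite mulr_sumr; apply: eq_bigr => j _; rewrite lieZl lieZr linearZ.
Qed.

Lemma killing0l X : killing 0 X = 0.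
Proof. by rewrite -(scale0r 0) killingZl mul0r. Qed.

Lemma killing0r X : killing X 0 = 0.
Proof. by rewrite -(scale0r 0) killingZr mul0r. Qed.

Let ad_g X : X \in g -> {in g, forall Y, ad X Y \in g}.
Proof. by move=> gX Y gY; rewrite adE; exact: fg_lie. Qed.

Lemma killingC X Y : X \in g -> Y \in g -> killing X Y = killing Y X.
Proof. by move=> gX gY; rewrite !killingE trvC//; exact: ad_g. Qed.

(** ad (f X) is conjugate to ad X by f, and the trace is cyclic. *)
Lemma killing_aut (f f' : 'End(M)) X Y :
  {in g, forall Z, f Z \in g} -> {in g, forall Z, f' Z \in g} ->
  {in g, cancel f f'} -> {in g, cancel f' f} ->
  {in g &, forall Z W, f (lie Z W) = lie (f Z) (f W)} ->
  X \in g -> Y \in g -> killing (f X) (f Y) = killing X Y.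
Proof.
move=> fg f'g fK f'K flie gX gY; rewrite !killingE.
have adf Z W : Z \in g -> W \in g -> ad (f Z) W = f (ad Z (f' W)).
  by move=> gZ gW; rewrite !adE flie ?f'K//; exact: f'g.
rewrite (@trv_eq _ _ _ _ (f \o (ad X \o ad Y \o f'))%VF); last first.
  move=> W gW; rewrite !comp_lfunE adf// adf//; last exact/fg/ad_g/f'g.
  by rewrite fK//; exact/ad_g/f'g.
rewrite trvC//; last first.
  by move=> W gW; rewrite !comp_lfunE; exact/ad_g/ad_g/f'g.
by apply: trv_eq => W gW; rewrite !comp_lfunE fK.
Qed.

(** By the Jacobi identity ad [X,Y] is the commutator of ad X and ad Y; the two sides
    then differ by a cyclic permutation under the trace. *)
Lemma killing_lie X Y Z : X \in g -> Y \in g -> Z \in g ->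
  killing (lie X Y) Z = killing X (lie Y Z).
Proof.
move=> gX gY gZ; rewrite !killingE.
have adB V W : W \in g -> ad (lie V W) = ((ad V \o ad W) - (ad W \o ad V))%VF.
  move=> _; apply/lfunP => T; rewrite add_lfunE opp_lfunE !comp_lfunE !adE.
  by rewrite lie_jacobi addrK.
rewrite !adB// comp_lfunDl comp_lfunDr comp_lfunNl comp_lfunNr.
rewrite -scaleN1r -[in RHS]scaleN1r !trvD !trvZ; congr (_ + _ * _).
  by rewrite comp_lfunA.
rewrite -comp_lfunA trvC; last 2 first.
- exact: ad_g.
- by move=> W gW; rewrite comp_lfunE; exact/ad_g/ad_g.
by rewrite comp_lfunA.
Qed.

(** Ad h as a bundled endomorphism, to be fed to killing_aut. *)
Definition Adl (h : M) : 'End(M) := (linfun (mulmxr (invmx h)) \o linfun (mulmx h))%VF.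

Lemma AdlE h X : Adl h X = Ad h X.
Proof. by rewrite comp_lfunE !lfunE. Qed.

Lemma Ad_lie h X Y : h \in unitmx -> Ad h (lie X Y) = lie (Ad h X) (Ad h Y).
Proof.
by move=> hu; rewrite /Ad /lie mulmxBr mulmxBl !mulmxA !(mulmxKV hu).
Qed.

Lemma killing_Ad h X Y : preserves_fg U h -> X \in g -> Y \in g ->
  killing (Ad h X) (Ad h Y) = killing X Y.
Proof.
move=> [hu hg hg'] gX gY; rewrite -!AdlE (@killing_aut _ (Adl (invmx h)))//.
- by move=> Z gZ; rewrite AdlE hg.
- by move=> Z gZ; rewrite AdlE hg'.
- by move=> Z gZ; rewrite !AdlE AdK.
- by move=> Z gZ; rewrite !AdlE AdVK.
- by move=> Z W gZ gW; rewrite !AdlE Ad_lie.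
Qed.

Lemma killing_AdV h X Y : preserves_fg U h -> X \in g -> Y \in g ->
  killing (Ad (invmx h) X) Y = killing X (Ad h Y).
Proof.
move=> hh gX gY; have [hu hg hg'] := hh.
by rewrite -(killing_Ad hh (hg' _ gX) gY) AdVK.
Qed.

End KillingInvariance.

(** * The involution *)

Section Involution.
Variables (R : realType) (n : nat) (U : set 'M[R[i]]_n).
Hypothesis hU : compact_unitary_group U.
Variables (Theta : 'M[R[i]]_n -> 'M[R[i]]_n) (dTheta : 'End('M[R[i]]_n)).
Hypothesis hTheta : holomorphic_involution U Theta dTheta.
Local Notation M := 'M[R[i]]_n.
Local Notation C := R[i].
Local Notation g := (fg U).
Local Notation u := (fu U).
Local Notation G := (grpG U).
Local Notation killing := (killing U).
Implicit Types X Y Z : M.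

Let ThetaG h : G h -> G (Theta h). Proof. by case: hTheta => -[+ _ _ _] _; exact. Qed.
Let ThetaM h k : G h -> G k -> Theta (h *m k) = Theta h *m Theta k.
Proof. by case: hTheta => -[_ + _ _] _; exact. Qed.
Let ThetaK h : G h -> Theta (Theta h) = h.
Proof. by case: hTheta => -[_ _ + _] _; exact. Qed.
Let ThetaU h : U h -> U (Theta h).
Proof. by case: hTheta => -[_ _ _ +] _; exact. Qed.

Let Gunit h : G h -> h \in unitmx.
Proof. by case/(grpG_preserves hU). Qed.

Lemma dTheta_fg X : X \in g -> dTheta X \in g.
Proof. by case: hTheta => _ /(_ X) + gX; case/(_ gX). Qed.

Lemma Theta_mexp X : X \in g -> Theta (mexp X) = mexp (dTheta X).
Proof. by case: hTheta => _ /(_ X) + gX; case/(_ gX). Qed.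

Lemma Theta_mexpZ (t : R) X : X \in g ->
  Theta (mexp (t%:C%C *: X)) = mexp (t%:C%C *: dTheta X).
Proof. by move=> gX; rewrite -linearZ Theta_mexp// memvZ. Qed.

Let Theta1 : Theta 1%:M = 1%:M.
Proof. by rewrite -mexp0 Theta_mexp ?linear0// mem0v. Qed.

Lemma ThetaV h : G h -> Theta (invmx h) = invmx (Theta h).
Proof.
have [_ _ _ GV] := grpG_subgroup hU.
move=> Gh; rewrite -[LHS](mulKmx (Gunit (ThetaG Gh))) -ThetaM//; last exact: GV.
by rewrite mulmxV ?Gunit// Theta1 mulmx1.
Qed.

(** Both sides generate the one-parameter group t |-> Theta(h exp(tX) h^-1). *)
Lemma dTheta_Ad h X : G h -> X \in g ->
  dTheta (Ad h X) = Ad (Theta h) (dTheta X).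
Proof.
have [_ _ GM GV] := grpG_subgroup hU.
move=> Gh gX; apply: mexp_inj => t.
have [hu hg _] := grpG_preserves hU Gh.
rewrite -Theta_mexpZ ?hg// -!Ad_scale (mexp_Ad _ hu) (mexp_Ad _ (Gunit (ThetaG Gh))).
have GX : G (mexp (t%:C%C *: X)) by apply: grpG_mexp; rewrite memvZ.
rewrite /Ad ThetaM; [|exact: GM|exact: GV].
by rewrite ThetaM// Theta_mexpZ// ThetaV.
Qed.

Lemma dThetaK X : X \in g -> dTheta (dTheta X) = X.
Proof.
move=> gX; apply: mexp_inj => t.
rewrite -Theta_mexpZ ?dTheta_fg// -Theta_mexpZ// ThetaK//.
by apply: grpG_mexp; rewrite memvZ.
Qed.

Lemma dTheta_fu X : u X -> u (dTheta X).
Proof.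
move=> uX; apply: fu_of_mexp => t.
by rewrite -Theta_mexpZ; [exact: ThetaU (fu_mexp t uX)|exact: fu_fg].
Qed.

(** dTheta preserves u, where the conjugate transpose is -1, and is complex linear,
    while the conjugate transpose is antilinear on g = u + iu. *)
Lemma dTheta_ctr X : X \in g -> dTheta (ctr X) = ctr (dTheta X).
Proof.
move=> /(fgP hU)[A [B [uA uB ->]]].
have tE (V W : M) c : dTheta (V + c *: W) = dTheta V + c *: dTheta W.
  by rewrite linearD linearZ.
rewrite tE !ctrD !ctrZ tE.
have sk Z : u Z -> dTheta (ctr Z) = ctr (dTheta Z).
  by move=> uZ; rewrite (fu_ctr hU uZ) linearN (fu_ctr hU (dTheta_fu uZ)).
by rewrite (sk _ uA) (sk _ uB).
Qed.

(** The derivative at t = 0 of dTheta (Ad(exp tX) Y) = Ad(exp t dTheta(X)) dTheta(Y). *)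
Lemma dTheta_lie X Y : X \in g -> Y \in g ->
  dTheta (lie X Y) = lie (dTheta X) (dTheta Y).
Proof.
move=> gX gY; have := mlim_linear dTheta (Ad_deriv0 X Y).
move/mlim_unique; apply.
have := Ad_deriv0 (dTheta X) (dTheta Y); congr (mlim _ _).
apply/funext => k /=; rewrite [RHS]linearZ /=; congr (_ *: _).
rewrite [RHS]linearB /= dTheta_Ad//.
  by rewrite /step Theta_mexpZ.
by apply: grpG_mexp; rewrite memvZ.
Qed.

Lemma killing_dTheta X Y : X \in g -> Y \in g ->
  killing (dTheta X) (dTheta Y) = killing X Y.
Proof.
move=> gX gY; apply: (@killing_aut _ _ _ hU dTheta dTheta) => //.
- exact: dTheta_fg.
- exact: dTheta_fg.
- exact: dThetaK.
- exact: dThetaK.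
- exact: dTheta_lie.
Qed.

(** dTheta is an isometry of the Killing form, so the value equals its opposite. *)
Lemma killing_eigen_orth X Y : X \in g -> Y \in g ->
  dTheta X = X -> dTheta Y = - Y -> killing X Y = 0.
Proof.
move=> gX gY tX tY; have := killing_dTheta gX gY.
rewrite tX tY killingC ?memvN// killingNl killingC// => /eqP.
by rewrite eq_sym -subr_eq0 opprK -mulr2n mulrn_eq0 => /eqP.
Qed.

Local Notation g0 := (fg0 U dTheta).

(** On g0 the two involutions -X^* and dTheta agree. *)
Lemma fg0P X : g0 X <-> X \in g /\ ctr X = - dTheta X.
Proof.
rewrite /fg0 /= /dsigma; split=> -[gX eX]; split => //.
  by rewrite -{2}eX dThetaK ?opprK// memvN (fg_ctr hU).
by rewrite eX opprK dThetaK.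
Qed.

Lemma grpG0_Ad h X : grpG0 U Theta h -> g0 X -> g0 (Ad h X).
Proof.
move=> [Gh sh] [gX sX]; have [hu hg _] := grpG_preserves hU Gh.
split; first exact: hg.
have Gc := grpG_cstar_inv hU Gh.
rewrite -{2}sX -{2}sh /dsigma /sigma -dTheta_Ad//; last first.
  by rewrite memvN fg_ctr.
congr (dTheta _); rewrite /Ad /cstar_inv !ctrM ctr_inv invmxK mulmxN mulNmx.
by rewrite mulmxA.
Qed.

Lemma grpG0V h : grpG0 U Theta h -> grpG0 U Theta (invmx h).
Proof.
move=> [Gh sh]; have [_ _ _ GV] := grpG_subgroup hU.
split; first exact: GV.
rewrite -{2}sh /sigma -ThetaV; last exact: grpG_cstar_inv.
by rewrite /cstar_inv ctr_inv.
Qed.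

Lemma fp_fg X : fp U dTheta X -> X \in g.
Proof.
move=> [uiX _]; have := memvZ (- 'i) (fu_fg uiX).
by rewrite scalerA mulNr i2E opprK scale1r.
Qed.

Lemma fp_ctr X : fp U dTheta X -> ctr X = X.
Proof.
move=> [uiX _]; have := fu_ctr hU uiX; rewrite ctrZ conjCi scaleNr => /oppr_inj.
by move/(congr1 ( *:%R (- 'i))); rewrite !scalerA mulNr i2E opprK !scale1r.
Qed.

Lemma fp_fg0 X : fp U dTheta X -> g0 X.
Proof.
move=> pX; apply/fg0P; split; first exact: fp_fg.
by rewrite fp_ctr//; case: pX => _ ->; rewrite opprK.
Qed.

Lemma fpP X : X \in g -> ctr X = X -> dTheta X = - X -> fp U dTheta X.
Proof.
move=> gX cX tX; split=> //; apply: (fu_of_skew hU); first exact: memvZ.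
by rewrite ctrZ conjCi cX scaleNr.
Qed.

(** For the converse, exp carries the segment from 0 to tX to a connected set of fixed
    points of Theta in U through 1, so exp(tX) stays in the identity component. *)
Lemma fkP X : fk U Theta X <-> u X /\ dTheta X = X.
Proof.
split=> [kX|[uX tX]].
  have K t : U (mexp (t%:C%C *: X)) /\ Theta (mexp (t%:C%C *: X)) = mexp (t%:C%C *: X).
    exact: (@connected_component_sub _ _ _ _ (kX t)).
  have uX : u X by apply: fu_of_mexp => t; case: (K t).
  split=> //; apply: mexp_inj => t; rewrite -Theta_mexpZ; last exact: fu_fg.
  by case: (K t).
move=> t; rewrite /grpK.
have cont : {within `[0, 1]%classic,
    continuous (fun s : R => mexp (s%:C%C *: (t%:C%C *: X)))}.
  by apply: continuous_subspaceT; exact: mexp_curve_continuous.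
have con := connected_continuous_connected (@segment_connected R 0 1) cont.
apply: (connected_component_max _ _ con).
- by exists 0; rewrite /= ?in_itv /= ?lexx ?ler01// scale0r mexp0.
- move=> _ [s _ <-]; split; first exact: fu_mexp (fuZ t uX).
  rewrite Theta_mexpZ; last exact: memvZ (fu_fg uX).
  by rewrite linearZ /= tX.
- exists 1; last by rewrite scale1r.
  by rewrite /= in_itv /= lexx ler01.
Qed.

End Involution.

(** * The Cartan subalgebra *)

Section CartanSubalgebra.
Variables (R : realType) (n : nat) (U : set 'M[R[i]]_n).
Hypothesis hU : compact_unitary_group U.
Variables (Theta : 'M[R[i]]_n -> 'M[R[i]]_n) (dTheta : 'End('M[R[i]]_n)).
Hypothesis hTheta : holomorphic_involution U Theta dTheta.
Hypothesis killing_neg : forall X, fu U X -> X <> 0 -> killing U X X < 0.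
Variable t0 : set 'M[R[i]]_n.
Hypothesis ht0 : maximal_abelian U Theta t0.
Local Notation M := 'M[R[i]]_n.
Local Notation C := R[i].
Local Notation g := (fg U).
Local Notation u := (fu U).
Local Notation killing := (killing U).
Local Notation g0 := (fg0 U dTheta).
Local Notation h0 := (fh0 U dTheta t0).
Local Notation h := (fh U dTheta t0).
Local Notation a0 := (fa0 U dTheta t0).
Implicit Types X Y Z H T : M.

Lemma ctr_lie X Y : ctr (lie X Y) = lie (ctr Y) (ctr X).
Proof. by rewrite /lie ctrB !ctrM. Qed.

Lemma t0P T : t0 T -> u T /\ dTheta T = T.
Proof. by case: ht0 => + _ _ => /[apply] /(fkP hTheta). Qed.

Lemma t0_h0 T : t0 T -> h0 T.
Proof.
move=> tT; have [uT TT] := t0P tT; split; last first.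
  by move=> Y tY; case: ht0 => _ /(_ T Y tT tY).
by apply/(fg0P hU hTheta); rewrite (fu_ctr hU uT) TT; split => //; exact: fu_fg.
Qed.

Lemma h0_g X : h0 X -> X \in g. Proof. by case=> -[]. Qed.

Lemma h0_ctr X : h0 X -> ctr X = - dTheta X.
Proof. by case=> /(fg0P hU hTheta)[]. Qed.

Lemma h0_dTheta X : h0 X -> h0 (dTheta X).
Proof.
move=> hX; have gX := h0_g hX; case: hX => g0X cX.
have /(fg0P hU hTheta)[_ eX] := g0X.
split.
  apply/(fg0P hU hTheta); split; first exact: (dTheta_fg hTheta).
  by rewrite -(dTheta_ctr hU hTheta) // eX linearN.
move=> T tT; have [uT <-] := t0P tT.
by rewrite -(dTheta_lie hU hTheta gX (fu_fg uT)) cX ?linear0.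
Qed.

Lemma half_double X : 2^-1 *: (X + X) = X.
Proof. by rewrite -mulr2n -[X *+ 2]scaler_nat scalerA mulVf ?scale1r// pnatr_eq0. Qed.

Lemma conj_half : (2^-1 : C)^* = 2^-1.
Proof. by rewrite fmorphV rmorph_nat. Qed.

(** The parts of X fixed and negated by dTheta still centralize t0. The first lies in
    k, hence in t0 because t0 is maximal abelian in k. *)
Lemma h0_decomp X : h0 X -> exists T Y, [/\ t0 T, a0 Y & X = T + Y].
Proof.
move=> hX; have gX := h0_g hX; have cX := h0_ctr hX.
have hTX := h0_dTheta hX; have gTX := h0_g hTX; have cTX := h0_ctr hTX.
have TTX := dThetaK hTheta gX; rewrite TTX in cTX.
exists (2^-1 *: (X + dTheta X)), (2^-1 *: (X - dTheta X)); split.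
- case: ht0 => _ _; apply; last first.
    move=> T tT; rewrite lieZl lieDl.
    by case: hX => _ ->//; case: hTX => _ ->//; rewrite addr0 scaler0.
  apply/(fkP hTheta); split; last by rewrite linearZ /= linearD /= TTX addrC.
  apply: (fu_of_skew hU); first by rewrite memvZ// memvD.
  by rewrite ctrZ conj_half ctrD cX cTX -opprD scalerN addrC.
- have pY : fp U dTheta (2^-1 *: (X - dTheta X)).
    apply: (fpP hU); first by rewrite memvZ// memvB.
      by rewrite ctrZ conj_half ctrB cX cTX opprK addrC.
    by rewrite linearZ /= linearB /= TTX -scalerN opprB.
  split => //; split; first exact: (fp_fg0 hU hTheta).
  move=> T tT; rewrite lieZl lieDl lieNl.
  by case: hX => _ ->//; case: hTX => _ ->//; rewrite subr0 scaler0.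
- by rewrite -scalerDr addrACA subrr addr0 half_double.
Qed.

(** [a0,a0] lies in k and centralizes t0, hence lies in t0; by invariance it is
    Killing-orthogonal to t0, so it vanishes by definiteness. *)
Lemma a0_abelian X Y : a0 X -> a0 Y -> lie X Y = 0.
Proof.
move=> [hX pX] [hY pY]; have gX := h0_g hX; have gY := h0_g hY.
have gW := fg_lie hU gX gY.
have tW : t0 (lie X Y).
  case: ht0 => _ _; apply.
    apply/(fkP hTheta); split.
      by apply: (fu_of_skew hU) => //; rewrite ctr_lie (fp_ctr hU pX) (fp_ctr hU pY) lieC.
    rewrite (dTheta_lie hU hTheta)//; case: pX => _ ->; case: pY => _ ->.
    by rewrite lieNl lieNr opprK.
  move=> T tT; rewrite lieC lie_jacobi.
  rewrite [lie T X]lieC [lie T Y]lieC; case: hX => _ ->//; case: hY => _ ->//.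
  by rewrite !oppr0 lie0l lie0r addr0 oppr0.
apply: contrapT => /(killing_neg (proj1 (t0P tW))).
rewrite (killing_lie hU)//; case: hY => _ ->//.
by rewrite killing0r ltxx.
Qed.

Lemma h0_abelian X Y : h0 X -> h0 Y -> lie X Y = 0.
Proof.
move=> hX /h0_decomp[T [Z [tT aZ ->]]]; rewrite lieDr.
case: (hX) => _ -> //; rewrite add0r.
have [T' [Z' [tT' aZ' ->]]] := h0_decomp hX.
rewrite lieDl (a0_abelian aZ' aZ) addr0 lieC.
by case: aZ => -[_ ->]//; rewrite oppr0.
Qed.

Lemma h0_h X : h0 X -> X \in h. Proof. exact: mem_vspan. Qed.

Lemma h_g H : H \in h -> H \in g.
Proof.
move: H; apply: vspan_ind; [exact: mem0v|exact: memvD|exact: memvZ|exact: h0_g].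
Qed.

Lemma h_abelian H H' : H \in h -> H' \in h -> lie H H' = 0.
Proof.
move=> + hH'; move: H; apply: vspan_ind.
- exact: lie0l.
- by move=> X Y eX eY; rewrite lieDl eX eY addr0.
- by move=> c X eX; rewrite lieZl eX scaler0.
move=> X hX; move: H' hH'; apply: vspan_ind.
- exact: lie0r.
- by move=> Y Z eY eZ; rewrite lieDr eY eZ addr0.
- by move=> c Y eY; rewrite lieZr eY scaler0.
- by move=> Y hY; exact: h0_abelian.
Qed.

Lemma h_ctr H : H \in h -> ctr H \in h.
Proof.
move: H; apply: vspan_ind.
- by rewrite ctr0 mem0v.
- by move=> X Y hX hY; rewrite ctrD memvD.
- by move=> c X hX; rewrite ctrZ memvZ.
- by move=> X hX; rewrite h0_ctr// memvN h0_h//; exact: h0_dTheta.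
Qed.

Lemma h_dTheta H : H \in h -> dTheta H \in h.
Proof.
move: H; apply: vspan_ind.
- by rewrite linear0 mem0v.
- by move=> X Y hX hY; rewrite linearD memvD.
- by move=> c X hX; rewrite linearZ memvZ.
- by move=> X hX; rewrite h0_h//; exact: h0_dTheta.
Qed.

Lemma h_g0 H : H \in h -> g0 H -> h0 H.
Proof.
by move=> hH gH; split=> // T tT; apply: h_abelian => //; exact/h0_h/t0_h0.
Qed.

Lemma fa_h X : fa U dTheta t0 X -> X \in h.
Proof.
move=> [T tT [Y [hY _]] <-]; rewrite memvD ?memvZ// h0_h//.
exact: t0_h0.
Qed.

Lemma killing_t0_a0 T Y : t0 T -> a0 Y -> killing Y T = 0.
Proof.
move=> tT [hY [_ pY]]; have [uT TT] := t0P tT.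
have gY := h0_g hY; have gT := fu_fg uT.
by rewrite (killingC hU gY gT) (killing_eigen_orth hU hTheta).
Qed.

End CartanSubalgebra.

(** * Roots *)

Section Roots.
Variables (R : realType) (n : nat) (U : set 'M[R[i]]_n).
Hypothesis hU : compact_unitary_group U.
Variables (Theta : 'M[R[i]]_n -> 'M[R[i]]_n) (dTheta : 'End('M[R[i]]_n)).
Hypothesis hTheta : holomorphic_involution U Theta dTheta.
Hypothesis killing_neg : forall X, fu U X -> X <> 0 -> killing U X X < 0.
Variable t0 : set 'M[R[i]]_n.
Hypothesis ht0 : maximal_abelian U Theta t0.
Local Notation M := 'M[R[i]]_n.
Local Notation C := R[i].
Local Notation g := (fg U).
Local Notation u := (fu U).
Local Notation killing := (killing U).
Local Notation g0 := (fg0 U dTheta).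
Local Notation h0 := (fh0 U dTheta t0).
Local Notation h := (fh U dTheta t0).
Local Notation a0 := (fa0 U dTheta t0).
Implicit Types (X Y Z H T : M) (al be : 'Hom(subvs_of h, C^o)).

(** Evaluates al, a form on the subspace type of h, at a matrix H of h. *)
Definition wt al H : C := al (vsproj h H).

Lemma root_spaceP al X : root_space al X <->
  X \in g /\ forall H, H \in h -> lie H X = wt al H *: X.
Proof.
split=> -[gX eX]; split=> // H; last by rewrite eX ?subvsP// /wt vsvalK.
by move=> hH; rewrite -{1}(vsprojK hH) eX.
Qed.

Lemma wtD al H H' : wt al (H + H') = wt al H + wt al H'.
Proof. by rewrite /wt !linearD. Qed.

Lemma wtZ al c H : wt al (c *: H) = c * wt al H.
Proof. by rewrite /wt !linearZ. Qed.

Lemma wtN al H : wt (- al) H = - wt al H.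
Proof. by rewrite /wt opp_lfunE. Qed.

Lemma wt_add al be H : wt (al + be) H = wt al H + wt be H.
Proof. by rewrite /wt add_lfunE. Qed.

Lemma wt_neq0 al : al <> 0 -> exists2 H, H \in h & wt al H != 0.
Proof.
move=> al0; apply: contrapT => noH; apply: al0; apply/lfunP => H.
rewrite zero_lfunE; apply/eqP/negPn/negP => alH; apply: noH.
by exists (vsval H); rewrite ?subvsP// /wt vsvalK.
Qed.

Lemma trace_ctr_eq0 X : \tr (X *m ctr X) = 0 -> X = 0.
Proof.
move=> trX; apply/matrixP => i j; rewrite mxE.
have nonneg k : 0 <= (X *m ctr X) k k.
  by rewrite mxE sumr_ge0// => l _; rewrite !mxE mul_conjC_ge0.
have := psumr_eq0P (fun k _ => nonneg k) trX (i := i) isT.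
rewrite mxE => /psumr_eq0P e; apply/eqP; rewrite -mul_conjC_eq0; apply/eqP.
have := e _ j isT; rewrite !mxE; apply => k _.
by rewrite !mxE mul_conjC_ge0.
Qed.

Lemma trace_ctr X : (\tr X)^* = \tr (ctr X).
Proof. by rewrite /mxtrace rmorph_sum; apply: eq_bigr => i _; rewrite !mxE. Qed.

Lemma trace_lie X Y Z : \tr (lie X Y *m Z) = \tr (Y *m lie Z X).
Proof.
have trB (V W : M) : \tr (V - W) = \tr V - \tr W by exact: raddfB.
rewrite /lie mulmxBl mulmxBr !trB; congr (_ - _).
  by rewrite -mulmxA mxtrace_mulC mulmxA.
by rewrite mulmxA.
Qed.

(** ad H is self-adjoint for the positive definite form tr(X Y^* ) when H is Hermitian,
    so its eigenvalues are real. *)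
Lemma wt_real al X H : root_space al X -> X <> 0 -> H \in h -> ctr H = H ->
  (wt al H)^* = wt al H.
Proof.
move=> /root_spaceP[_ eX] X0 hH cH.
have s0 : \tr (X *m ctr X) != 0 by apply/eqP => /trace_ctr_eq0.
have sE : (\tr (X *m ctr X))^* = \tr (X *m ctr X).
  by rewrite trace_ctr ctrM trmxCK.
have wE : \tr (lie H X *m ctr X) = wt al H * \tr (X *m ctr X).
  by rewrite eX// -scalemxAl mxtraceZ.
apply: (mulIf s0).
have -> : (wt al H)^* * \tr (X *m ctr X) = (wt al H * \tr (X *m ctr X))^*.
  by rewrite rmorphM /= sE.
rewrite -wE trace_ctr ctrM trmxCK ctr_lie cH.
exact/esym/trace_lie.
Qed.

(** Write H = H1 + i H2 with H1 and H2 Hermitian elements of h. Since al is real on H1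
    and H2, the conjugate of al(H^* ) is al(H). *)
Lemma root_space_ctr al X : Defs.roots al -> root_space al X -> root_space (- al) (ctr X).
Proof.
move=> [_ [Z aZ Z0]] /root_spaceP[gX eX]; apply/root_spaceP.
split=> [|H hH]; first exact: (fg_ctr hU).
have hcH : ctr H \in h by exact: (h_ctr hU hTheta).
have real K : K \in h -> ctr K = K -> (wt al K)^* = wt al K by exact: wt_real aZ Z0.
pose H1 := 2^-1 *: (H + ctr H); pose H2 := 2^-1 *: ('i *: (ctr H - H)).
have hH1 : H1 \in h by rewrite memvZ ?memvD.
have hH2 : H2 \in h by rewrite !memvZ ?memvB.
have cH1 : ctr H1 = H1 by rewrite ctrZ conj_half ctrD trmxCK addrC.
have cH2 : ctr H2 = H2.
  by rewrite !ctrZ conj_half conjCi ctrB trmxCK scaleNr -scalerN opprB.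
have HE : H = H1 + 'i *: H2.
  apply/matrixP => i j; rewrite /H1 /H2 !mxE.
  by field: (@i2E R).
clearbody H1 H2.
have cHE : ctr H = H1 - 'i *: H2.
  by rewrite HE ctrD ctrZ cH1 cH2 conjCi scaleNr.
have wE : (wt al (ctr H))^* = wt al H.
  have cNi : (- 'i : C)^* = 'i by rewrite rmorphN /= conjCi opprK.
  rewrite cHE HE -scaleNr wtD wtZ (wtD al H1) wtZ rmorphD rmorphM /= cNi.
  by rewrite (real _ hH1 cH1) (real _ hH2 cH2).
clear HE cHE.
rewrite -[H in lie H]trmxCK -[lie _ _]opprK -lieC -ctr_lie eX// ctrZ wE wtN.
by rewrite scaleNr.
Qed.

Lemma root_space_lie al be X Y : root_space al X -> root_space be Y ->
  root_space (al + be) (lie X Y).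
Proof.
move=> /root_spaceP[gX eX] /root_spaceP[gY eY]; apply/root_spaceP.
split; first exact: (fg_lie hU).
by move=> H hH; rewrite lie_jacobi (eX _ hH) (eY _ hH) lieZl lieZr -scalerDl wt_add.
Qed.

(** If al(K) is nonzero then al(K) <H,X> = <H,[K,X]> = <[H,K],X> = 0. *)
Lemma killing_h_root al X H : al <> 0 -> root_space al X -> H \in h ->
  killing H X = 0.
Proof.
move=> /wt_neq0[K hK w0] /root_spaceP[gX eX] hH.
have gH := h_g hH; have gK := h_g hK.
have : killing H (lie K X) = 0.
  rewrite -(killing_lie hU)// (h_abelian hU hTheta killing_neg ht0)//.
  by rewrite killing0l.
by rewrite (eX _ hK) killingZr => /eqP; rewrite mulf_eq0 (negPf w0) => /eqP.
Qed.

Variable P : set 'Hom(subvs_of h, C^o).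
Hypothesis hP : theta_stable_triangular P.
Local Notation np := (nplus P).
Local Notation nm := (nminus P).

Let P_roots al : P al -> Defs.roots al.
Proof. by case: hP => -[+ _ _] _ _ _; exact. Qed.

Lemma nplus_ctr X : X \in np -> ctr X \in nm.
Proof.
move: X; apply: vspan_ind.
- by rewrite ctr0 mem0v.
- by move=> X Y hX hY; rewrite ctrD memvD.
- by move=> c X hX; rewrite ctrZ memvZ.
move=> X [al Pal rX]; apply: mem_vspan; exists al => //.
exact: root_space_ctr (P_roots Pal) rX.
Qed.

Lemma nminus_ctr X : X \in nm -> ctr X \in np.
Proof.
move: X; apply: vspan_ind.
- by rewrite ctr0 mem0v.
- by move=> X Y hX hY; rewrite ctrD memvD.
- by move=> c X hX; rewrite ctrZ memvZ.
move=> X [al Pal rX]; apply: mem_vspan; exists al => //.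
have [X0|X0] := pselect (X = 0).
  rewrite X0 ctr0; apply/root_spaceP; split; first exact: mem0v.
  by move=> H _; rewrite lie0r scaler0.
rewrite -[al]opprK; apply: root_space_ctr => //.
have [al0 [Z rZ Z0]] := P_roots Pal; split.
  by move=> /eqP; rewrite oppr_eq0 => /eqP.
by exists X.
Qed.

Lemma nminus_g X : X \in nm -> X \in g.
Proof.
move: X; apply: vspan_ind; [exact: mem0v|exact: memvD|exact: memvZ|].
by move=> X [al _ []].
Qed.

Lemma nplus_g X : X \in np -> X \in g.
Proof.
move: X; apply: vspan_ind; [exact: mem0v|exact: memvD|exact: memvZ|].
by move=> X [al _ []].
Qed.

Lemma lie_h_nminus H X : H \in h -> X \in nm -> lie H X \in nm.
Proof.
move=> hH; move: X; apply: vspan_ind.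
- by rewrite lie0r mem0v.
- by move=> X Y eX eY; rewrite lieDr memvD.
- by move=> c X eX; rewrite lieZr memvZ.
move=> X [al Pal rX]; have /root_spaceP[_ ->//] := rX.
by apply: memvZ; apply: mem_vspan; exists al.
Qed.

(** For positive al and be, a nonzero bracket of vectors of weights -al and -be has
    weight -(al + be), so al + be is a root, and a positive one. *)
Lemma lie_nminus X Y : X \in nm -> Y \in nm -> lie X Y \in nm.
Proof.
move=> + nY; move: X; apply: vspan_ind.
- by rewrite lie0l mem0v.
- by move=> X Z eX eZ; rewrite lieDl memvD.
- by move=> c X eX; rewrite lieZl memvZ.
move=> X [al Pal rX]; move: Y nY; apply: vspan_ind.
- by rewrite lie0r mem0v.
- by move=> Y Z eX eY; rewrite lieDr memvD.
- by move=> c Y eY; rewrite lieZr memvZ.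
move=> Y [be Pbe rY].
have [->|W0] := pselect (lie X Y = 0); first exact: mem0v.
have rW := root_space_lie rX rY; rewrite -opprD in rW.
apply: mem_vspan; exists (al + be) => //.
have [[Psub Ppm Padd] _ _ _] := hP.
have ab0 : al + be <> 0.
  move=> ab0; have [_ []] := Ppm _ (P_roots Pal); split => //.
  by rewrite (_ : - al = be)//; apply/eqP; rewrite eq_sym -addr_eq0 addrC ab0.
have rnW : Defs.roots (- (al + be)).
  by split; [move=> /eqP; rewrite oppr_eq0 => /eqP|exists (lie X Y)].
apply: Padd => //; split=> //; exists (ctr (lie X Y)).
  by rewrite -[al + be]opprK; exact: root_space_ctr.
by move=> /(congr1 (fun Z => ctr Z)); rewrite trmxCK ctr0.
Qed.

End Roots.

Lemma addrCC (V : zmodType) (x y z : V) : x + y + z = z + y + x.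
Proof. by rewrite addrC [x + y]addrC addrA. Qed.

(** * The triangular decomposition and the operator hilb *)

Section Triangular.
Variables (R : realType) (n : nat) (U : set 'M[R[i]]_n).
Hypothesis hU : compact_unitary_group U.
Variables (Theta : 'M[R[i]]_n -> 'M[R[i]]_n) (dTheta : 'End('M[R[i]]_n)).
Hypothesis hTheta : holomorphic_involution U Theta dTheta.
Hypothesis killing_neg : forall X, fu U X -> X <> 0 -> killing U X X < 0.
Variable t0 : set 'M[R[i]]_n.
Hypothesis ht0 : maximal_abelian U Theta t0.
Local Notation M := 'M[R[i]]_n.
Local Notation C := R[i].
Local Notation g := (fg U).
Local Notation killing := (killing U).
Local Notation g0 := (fg0 U dTheta).
Local Notation p := (fp U dTheta).
Local Notation h0 := (fh0 U dTheta t0).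
Local Notation h := (fh U dTheta t0).
Local Notation a0 := (fa0 U dTheta t0).
Variable P : set 'Hom(subvs_of h, C^o).
Hypothesis hP : theta_stable_triangular P.
Local Notation np := (nplus P).
Local Notation nm := (nminus P).
Implicit Types (X Y Z H T A B : M).

Lemma killing_h_span (Q : 'Hom(subvs_of h, C^o) -> 'Hom(subvs_of h, C^o)) H X :
  (forall al, P al -> Q al <> 0) -> H \in h ->
  X \in vspan (\bigcup_(al in P) root_space (Q al)) -> killing H X = 0.
Proof.
move=> Q0 hH; move: X; apply: vspan_ind.
- exact: killing0r.
- by move=> X Y kX kY; rewrite killingDr kX kY addr0.
- by move=> c X kX; rewrite killingZr kX mulr0.
move=> X [al Pal rX].
exact: (killing_h_root hU hTheta killing_neg ht0 (Q0 _ Pal) rX hH).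
Qed.

Let P_neq0 al : P al -> al <> 0.
Proof. by case: hP => -[+ _ _] _ _ _ => /[apply] -[]. Qed.

Lemma killing_h_nplus H X : H \in h -> X \in np -> killing H X = 0.
Proof. by apply: (@killing_h_span id) => al; exact: P_neq0. Qed.

Lemma killing_h_nminus H X : H \in h -> X \in nm -> killing H X = 0.
Proof.
apply: (@killing_h_span -%R) => al /P_neq0 al0 /eqP.
by rewrite oppr_eq0 => /eqP.
Qed.

Lemma tri_decomp X : X \in g ->
  exists A H B, [/\ A \in nm, H \in h, B \in np & X = A + H + B].
Proof.
case: hP => _ [<- _] _ _ /memv_addP[Z /memv_addP[A nA [H hH ->]] [B nB ->]].
by exists A, H, B; split; [exact: nA|exact: hH|exact: nB|].
Qed.

Let cap_plus : (np :&: (nm + h) = 0)%VS.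
Proof.
by case: hP => _ [_ +] _ _; rewrite directv_addE capvC => /and3P[_ _ /eqP].
Qed.

Let cap_minus : (nm :&: (h + np) = 0)%VS.
Proof.
have cap_nm_h : (nm :&: h = 0)%VS.
  by case: hP => _ [_ +] _ _; rewrite directv_addE => /and3P[/directv_addP].
apply/eqP; rewrite -subv0; apply/subvP => A.
rewrite memv_cap => /andP[nA /memv_addP[H hH [B nB eA]]].
have B0 : B = 0.
  apply/eqP; rewrite -memv0 -cap_plus memv_cap nB.
  by rewrite (_ : B = A - H) ?memv_add ?memvN// eA addrAC subrr add0r.
by rewrite -cap_nm_h memv_cap nA eA B0 addr0.
Qed.

Lemma daddv_pi_compl (V W : {vspace M}) X : (V :&: W = 0)%VS -> X \in W ->
  daddv_pi V W X = 0.
Proof.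
move=> VW WX; have WV : (W :&: V = 0)%VS by rewrite capvC.
have := daddv_pi_add VW (subvP (addvSr V W) _ WX).
set a := daddv_pi V W X; set b := daddv_pi W V X => e.
have eb : b = X by exact: daddv_pi_id.
by move: e; rewrite eb -[RHS]add0r => /addIr.
Qed.

Lemma proj_minusE A H B : A \in nm -> H \in h -> B \in np ->
  proj_minus P (A + H + B) = A.
Proof.
move=> nA hH nB; rewrite /proj_minus -addrA linearD /= (daddv_pi_id cap_minus nA).
by rewrite (daddv_pi_compl cap_minus (memv_add hH nB)) addr0.
Qed.

Lemma proj_plusE A H B : A \in nm -> H \in h -> B \in np ->
  proj_plus P (A + H + B) = B.
Proof.
move=> nA hH nB; rewrite /proj_plus linearD /= (daddv_pi_id cap_plus nB).
by rewrite (daddv_pi_compl cap_plus (memv_add nA hH)) add0r.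
Qed.

Lemma hilbE A H B : A \in nm -> H \in h -> B \in np ->
  hilb P (A + H + B) = - ('i *: A) + 'i *: B.
Proof.
move=> nA hH nB; congr (- ('i *: _) + 'i *: _).
  exact: proj_minusE.
exact: proj_plusE.
Qed.

Lemma tri_unique A H B A' H' B' : A \in nm -> H \in h -> B \in np ->
  A' \in nm -> H' \in h -> B' \in np -> A + H + B = A' + H' + B' ->
  [/\ A = A', H = H' & B = B'].
Proof.
move=> nA hH nB nA' hH' nB' e.
have eA : A = A' by rewrite -(proj_minusE nA hH nB) e (proj_minusE nA' hH' nB').
have eB : B = B' by rewrite -(proj_plusE nA hH nB) e (proj_plusE nA' hH' nB').
by split=> //; move: e; rewrite eA eB => /addIr /addrI.
Qed.

Let ctr_nplus X : X \in np -> ctr X \in nm := @nplus_ctr _ _ _ hU _ _ hTheta _ ht0 _ hP X.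
Let ctr_nminus X : X \in nm -> ctr X \in np := @nminus_ctr _ _ _ hU _ _ hTheta _ ht0 _ hP X.
Let ctr_h X : X \in h -> ctr X \in h := @h_ctr _ _ _ hU _ _ hTheta _ ht0 X.

(** The conjugation X |-> dTheta(-X^* ) fixing g0 exchanges n^- and n^+ and preserves
    h; compare components. *)
Lemma g0_components A H B : A \in nm -> H \in h -> B \in np -> g0 (A + H + B) ->
  [/\ dTheta (ctr A) = - B, dTheta (ctr B) = - A & g0 H].
Proof.
move=> nA hH nB [gX]; rewrite /dsigma linearN /= !ctrD.
have dD V W : dTheta (V + W) = dTheta V + dTheta W by rewrite linearD.
rewrite !dD => e.
have [_ _ Tp Tm] := hP.
have [eA eH eB] : [/\ - dTheta (ctr B) = A, - dTheta (ctr H) = H & - dTheta (ctr A) = B].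
  apply: (tri_unique _ _ _ nA hH nB); last by rewrite -e !opprD addrCC.
  - by rewrite memvN; exact: Tm (ctr_nplus nB).
  - by rewrite memvN; exact: (h_dTheta hU hTheta ht0 (ctr_h hH)).
  - by rewrite memvN; exact: Tp (ctr_nminus nA).
split; [by rewrite -[in RHS]eB opprK|by rewrite -[in RHS]eA opprK|].
split; first exact: h_g hH.
by rewrite /dsigma linearN.
Qed.

(** The conjugation fixing g0 exchanges n^- and n^+ and conjugates the eigenvalues -i
    and i of hilb there, so it commutes with hilb. *)
Lemma hilb_g0 X : g0 X -> g0 (hilb P X).
Proof.
move=> gX; have [A [H [B [nA hH nB eX]]]] := tri_decomp (proj1 gX).
have [eA eB _] : [/\ dTheta (ctr A) = - B, dTheta (ctr B) = - A & g0 H].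
  by apply: g0_components; rewrite -?eX.
rewrite eX hilbE//; split.
  by rewrite memvD ?memvN ?memvZ// ?(nminus_g nA)// (nplus_g nB).
rewrite /dsigma ctrD ctrN !ctrZ conjCi !scaleNr opprK opprB linearB !linearZ /= eA eB.
by rewrite !scalerN opprK.
Qed.

Lemma Ad_invmxM_mexp X Y Z :
  Ad (invmx (mexp X *m mexp Y)) Z = Ad (mexp (- Y)) (Ad (mexp (- X)) Z).
Proof.
have -> : invmx (mexp X *m mexp Y) = mexp (- Y) *m mexp (- X).
  by rewrite -(invmx_mexp Y) -(invmx_mexp X); exact: invmxM (mexp_unit X) (mexp_unit Y).
exact: AdM _ (mexp_unit (- Y)) (mexp_unit (- X)).
Qed.

(** N^- A acts on b^- = h + n^- and trivially on b^- / n^- = h. *)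
Lemma Ad_borel (l a : M) H A : grpNminus P l -> grpA U dTheta t0 a ->
  H \in h -> A \in nm ->
  exists2 A', A' \in nm & Ad (invmx (l *m a)) (H + A) = H + A'.
Proof.
move=> [N nN <-] [Y aY <-] hH nA.
have hY : Y \in h := fa_h hU hTheta ht0 aY.
rewrite Ad_invmxM_mexp.
have nN' : - N \in nm by rewrite memvN.
have hY' : - Y \in h by rewrite memvN.
have n1 : Ad (mexp (- N)) (H + A) - (H + A) \in nm.
  apply: (@Ad_mexp_sub _ _ (h + nm)%VS) => [Z /memv_addP[H' hH' [A' nA' ->]]|Z nZ|].
  - rewrite lieDr; apply: memvD; last exact: (lie_nminus hU hTheta ht0 hP).
    by rewrite lieC memvN; exact: lie_h_nminus.
  - exact: (lie_nminus hU hTheta ht0 hP).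
  - exact: memv_add.
have a_h : Ad (mexp (- Y)) H = H.
  apply/eqP; rewrite -subr_eq0 -memv0.
  apply: (@Ad_mexp_sub _ _ h) => // Z; last by rewrite !memv0 => /eqP->; rewrite lie0r.
  by move=> hZ; rewrite (h_abelian hU hTheta killing_neg ht0) ?memv0.
have Y_n W : W \in nm -> lie (- Y) W \in nm by exact: lie_h_nminus.
have a_n Z : Z \in nm -> Ad (mexp (- Y)) Z \in nm.
  move=> nZ; rewrite -[Ad _ Z](subrK Z); apply: (memvD _ nZ).
  exact: (Ad_mexp_sub Y_n Y_n nZ).
pose D := Ad (mexp (- N)) (H + A) - (H + A).
have eD : Ad (mexp (- N)) (H + A) = H + (D + A) by rewrite addrCA /D subrK.
exists (Ad (mexp (- Y)) (D + A)); first exact: a_n (memvD n1 nA).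
apply: (etrans (congr1 (Ad (mexp (- Y))) eD)).
by rewrite Ad_add; congr (_ + _).
Qed.

(** The conjugate transpose exchanges n^- and n^+. As k + v has no component in n^+, the
    components of k are -v_+ in n^+ and, k being skew and v Hermitian, v_- in n^-. Hence
    hilb v = -i v_- + i v_+ is -i k up to the component of k in h. On h, comparing the
    Hermitian and skew parts of k + v = -i (T + Y), with T skew in t0 and Y Hermitian in
    a0, leaves -i T to v and -i Y to k. *)
Lemma hilb_hermitian_skew v k A X0 : v \in g -> ctr v = v -> ctr k = - k ->
  A \in nm -> h0 X0 -> k + v = A - 'i *: X0 ->
  exists T Y A' B', [/\ t0 T, a0 Y, A' \in nm /\ B' \in np,
    v = A' - 'i *: T + B' & hilb P v = - ('i *: k) + Y].
Proof.
move=> gv cv ck nA hX0 ekv.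
have [T [Y [tT aY eX0]]] := h0_decomp hU hTheta ht0 hX0.
have [Vm [V0 [Vp [nVm hV0 nVp ev]]]] := tri_decomp gv.
have hT : T \in h := h0_h (t0_h0 hU hTheta ht0 tT).
have hY : Y \in h by case: aY => hY _; exact: h0_h.
have cT : ctr T = - T := fu_ctr hU (proj1 (t0P hTheta ht0 tT)).
have cY : ctr Y = Y by case: aY => _ pY; exact: (fp_ctr hU pY).
have [cVp cV0 cVm] : [/\ ctr Vp = Vm, ctr V0 = V0 & ctr Vm = Vp].
  apply: (tri_unique (ctr_nplus nVp) (ctr_h hV0) (ctr_nminus nVm) nVm hV0 nVp).
  by rewrite -ev -[RHS]cv ev !ctrD addrCC.
pose K0 := - ('i *: X0) - V0.
have hK0 : K0 \in h.
  by apply: memvB hV0; rewrite memvN; exact: memvZ (h0_h hX0).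
have nAV : A - Vm \in nm := memvB nA nVm.
have nVA : Vm - A \in nm := memvB nVm nA.
have nVp' : - Vp \in np by rewrite memvN; exact: nVp.
have ek : k = (A - Vm) + K0 + - Vp.
  by rewrite -[k](addrK v) ekv ev; apply/matrixP => i j; rewrite !mxE; ring.
have [eA eK0 _] : [/\ ctr (- Vp) = Vm - A, ctr K0 = - K0 & ctr (A - Vm) = Vp].
  have hNK0 : - K0 \in h by rewrite memvN.
  apply: (tri_unique (ctr_nplus nVp') (ctr_h hK0) (ctr_nminus nAV) nVA hNK0 nVp).
  rewrite addrCC -!ctrD -ek ck ek.
  by apply/matrixP => i j; rewrite !mxE; ring.
have eVm : A - Vm = Vm.
  by move: eA; rewrite ctrN cVp => /eqP; rewrite eqr_oppLR opprB => /eqP.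
have eV0 : V0 = - ('i *: T).
  apply/eqP; rewrite -addr_eq0 addrC; apply/eqP/eq_opp0.
  move: eK0; rewrite /K0 eX0 ctrB ctrN ctrZ conjCi ctrD cT cY cV0 scaleNr opprK.
  rewrite !scalerDr scalerN opprB opprK => e.
  have eT : 'i *: T + V0 = V0 + ('i *: T + 'i *: Y) - 'i *: Y.
    by rewrite addrA addrK addrC.
  rewrite {1}eT -e; apply/matrixP => i j; rewrite !mxE; ring.
have eK0' : K0 = - ('i *: Y).
  by rewrite /K0 eV0 eX0 scalerDr opprD opprK addrAC addNr add0r.
exists T, Y, Vm, Vp; split=> //; first by rewrite ev eV0.
rewrite ev (hilbE nVm hV0 nVp) ek eVm eK0'.
apply/matrixP => i j; rewrite !mxE; ring: (@i2E R).
Qed.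

End Triangular.

(** * Orthogonal projection onto real subspaces of p *)

Section OrthogonalComplement.
Variables (R : realType) (n : nat) (U : set 'M[R[i]]_n).
Hypothesis hU : compact_unitary_group U.
Variable dTheta : 'End('M[R[i]]_n).
Hypothesis killing_neg : forall X, fu U X -> X <> 0 -> killing U X X < 0.
Local Notation M := 'M[R[i]]_n.
Local Notation C := R[i].
Local Notation g := (fg U).
Local Notation killing := (killing U).
Local Notation p := (fp U dTheta).
Implicit Types X Y Z : M.

Lemma fp0 : p 0.
Proof. by split; rewrite ?scaler0 ?linear0 ?oppr0//; exact: fu0. Qed.

Lemma fpD X Y : p X -> p Y -> p (X + Y).
Proof.
move=> [uX tX] [uY tY]; split; first by rewrite scalerDr; exact: fuD.
by rewrite linearD /= tX tY opprD.
Qed.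

Lemma fpZ (t : R) X : p X -> p (t%:C%C *: X).
Proof.
move=> [uX tX]; split; last by rewrite linearZ /= tX scalerN.
by rewrite scalerA mulrC -scalerA; exact: fuZ.
Qed.

Lemma fpN X : p X -> p (- X).
Proof.
by move=> pX; rewrite -scaleN1r -(rmorphN1 (real_complex R)); exact: fpZ pX.
Qed.

Lemma fpB X Y : p X -> p Y -> p (X - Y).
Proof. by move=> pX pY; exact: fpD pX (fpN pY). Qed.

Lemma killing_fp_gt0 X : p X -> X <> 0 -> 0 < killing X X.
Proof.
move=> pX X0; have [uiX _] := pX; have gX := fp_fg pX.
have iX0 : 'i *: X <> 0.
  by move=> /eqP; rewrite scaler_eq0 (negPf (neq0Ci _)) /= => /eqP.
have := killing_neg uiX iX0.
rewrite killingZl killingZr mulrA i2E mulN1r.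
by rewrite oppr_lt0.
Qed.

(** Polarization: the form is real on the diagonal. *)
Lemma killing_fp_real X Y : p X -> p Y -> exists t : R, killing X Y = t%:C%C.
Proof.
move=> pX pY; have gX := fp_fg pX; have gY := fp_fg pY.
have sq Z : p Z -> killing Z Z \is Num.real.
  have [->|/eqP Z0] := eqVneq Z 0; last by move=> pZ; rewrite gtr0_real// killing_fp_gt0.
  by rewrite killing0l.
exists (complex.Re (killing X Y)); rewrite RRe_real//.
have : killing X Y *+ 2 \is Num.real.
  rewrite (_ : _ *+ 2 = killing (X + Y) (X + Y) - killing X X - killing Y Y).
    by rewrite !rpredB ?sq//; exact: fpD.
  rewrite killingDl !killingDr (killingC hU gY gX).
  by move: (killing X X) (killing X Y) (killing Y Y) => a b c; ring.
by rewrite -mulr_natl => /(rpredM (rpredVr (realn _ 2))); rewrite mulKf// pnatr_eq0.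
Qed.

(** Induction on the complex dimension of the span of W: split off a nonzero vector e of
    W and pass to its orthogonal W' in W. The span of W' omits e because the complex
    bilinear form <.,e> vanishes on it but not at e. The remaining coefficients along e
    are real, so the projection stays in W. *)
Lemma fp_orth_proj (W : set M) X : real_subspace W -> W `<=` p -> p X ->
  exists2 w, W w & forall y, W y -> killing (X - w) y = 0.
Proof.
have [d] := ubnP (\dim (vspan W)); elim: d W X => // d IH W X dW [W0 WD WZ] Wp pX.
have [Wtriv|] := pselect (forall e, W e -> e = 0).
  by exists 0 => // y /Wtriv ->; rewrite killing0r.
move=> /existsNP[e /not_implyP[We e0]].
have pe := Wp _ We; have ge := fp_fg pe; have gX := fp_fg pX.
have ee := killing_fp_gt0 pe e0; have ee0 : killing e e != 0 by rewrite gt_eqF.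
have [tee teeE] := killing_fp_real pe pe.
pose W' := [set w | W w /\ killing w e = 0].
have W'W w : W' w -> W w by case.
have sW' : real_subspace W'.
  split.
  - by split=> //; rewrite killing0l.
  - by move=> v w [Wv ve] [Ww we]; split; [exact: WD|rewrite killingDl ve we addr0].
  - by move=> t w [Ww we]; split; [exact: WZ|rewrite killingZl we mulr0].
have W'p : W' `<=` p by move=> w /W'W /Wp.
have lt_dim : (\dim (vspan W') < d)%N.
  rewrite ltnS in dW; apply: leq_trans dW.
  have sub : (vspan W' <= vspan W)%VS.
    by case: (vspanP W') => _; apply => w /W'W; exact: mem_vspan.
  rewrite ltn_neqAle dimvS// andbT; apply/negP => /eqP eqd.
  have eW' : vspan W' = vspan W by apply/eqP; rewrite eqEdim sub eqd leqnn.
  have : e \in vspan W' by rewrite eW'; exact: mem_vspan.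
  move=> /(vspan_ind (Q := fun v => killing v e = 0)) => ke.
  move/eqP: ee0; apply; apply: ke.
  - by rewrite killing0l.
  - by move=> v w ve we; rewrite killingDl ve we addr0.
  - by move=> c v ve; rewrite killingZl ve mulr0.
  - by move=> w [].
have [w' [Ww' w'e] orth] := IH W' X lt_dim sW' W'p pX.
have real_coef v : p v -> exists t : R, killing v e / killing e e = t%:C%C.
  move=> pv; have [t tE] := killing_fp_real pv pe.
  by exists (t / tee); rewrite tE teeE -fmorphV -rmorphM.
have [c cE] := real_coef X pX.
exists (w' + c%:C%C *: e); first by apply: WD => //; exact: WZ.
have gw' := fp_fg (Wp _ Ww').
have orthe : killing (X - (w' + c%:C%C *: e)) e = 0.
  by rewrite killingBl killingDl killingZl w'e -cE add0r divfK// subrr.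
move=> y Wy; have py := Wp _ Wy; have [b bE] := real_coef y py.
pose y' := y - b%:C%C *: e.
have W'y' : W' y'.
  split; last by rewrite killingBl killingZl -bE divfK// subrr.
  rewrite /y' -scaleNr -rmorphN; apply: WD => //; exact: WZ.
have ey' : killing e y' = 0.
  by rewrite (killingC hU ge (fp_fg (W'p _ W'y'))); case: W'y'.
have -> : y = y' + b%:C%C *: e by rewrite subrK.
rewrite killingDr killingZr orthe mulr0 addr0.
by rewrite opprD addrA killingBl killingZl ey' mulr0 subr0; exact: orth.
Qed.

End OrthogonalComplement.

(** * The two forms along a leaf *)

Section Main.
Variables (R : realType) (n : nat) (U : set 'M[R[i]]_n).
Hypothesis hU : compact_unitary_group U.
Variables (Theta : 'M[R[i]]_n -> 'M[R[i]]_n) (dTheta : 'End('M[R[i]]_n)).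
Hypothesis hTheta : holomorphic_involution U Theta dTheta.
Hypothesis killing_neg : forall X, fu U X -> X <> 0 -> killing U X X < 0.
Variable t0 : set 'M[R[i]]_n.
Hypothesis ht0 : maximal_abelian U Theta t0.
Local Notation M := 'M[R[i]]_n.
Local Notation C := R[i].
Local Notation g := (fg U).
Local Notation killing := (killing U).
Local Notation p := (fp U dTheta).
Local Notation h := (fh U dTheta t0).
Variable P : set 'Hom(subvs_of h, C^o).
Hypothesis hP : theta_stable_triangular P.
Implicit Types X Y Z : M.

Lemma fp_part Z : fg0 U dTheta Z -> p (2^-1 *: (Z - dTheta Z)).
Proof.
move=> /(fg0P hU hTheta)[gZ cZ].
have TZ := dThetaK hTheta gZ; have gTZ := dTheta_fg hTheta gZ.
apply: (fpP hU); first exact: memvZ (memvB gZ gTZ).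
  rewrite ctrZ conj_half ctrB cZ -(dTheta_ctr hU hTheta gZ) cZ linearN /= TZ.
  by rewrite opprK addrC.
by rewrite linearZ /= linearB /= TZ -scalerN opprB.
Qed.

Lemma fk_part Z : fg0 U dTheta Z -> let K := 2^-1 *: (Z + dTheta Z) in
  [/\ K \in g, dTheta K = K, ctr K = - K & Z = 2^-1 *: (Z - dTheta Z) + K].
Proof.
move=> /(fg0P hU hTheta)[gZ cZ] /=.
have TZ := dThetaK hTheta gZ; have gTZ := dTheta_fg hTheta gZ; split.
- exact: memvZ (memvD gZ gTZ).
- by rewrite linearZ /= linearD /= TZ addrC.
- rewrite ctrZ conj_half ctrD cZ -(dTheta_ctr hU hTheta gZ) cZ linearN /= TZ.
  by rewrite -opprD scalerN addrC.
- by rewrite -scalerDr addrACA addNr addr0 half_double.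
Qed.

(** The two eigenspaces of dTheta are orthogonal, which makes this an orthogonal
    projection; it is the only one because the form is definite on p. *)
Lemma orth_projE Z : fg0 U dTheta Z ->
  orth_proj U p Z = 2^-1 *: (Z - dTheta Z).
Proof.
move=> gZ; have pZ := fp_part gZ; have [gK TK _ eZ] := fk_part gZ.
have orth v : p v -> killing (Z - 2^-1 *: (Z - dTheta Z)) v = 0.
  move=> pv; rewrite {1}eZ addrAC subrr add0r.
  by apply: (killing_eigen_orth hU hTheta gK (fp_fg pv) TK); case: pv.
apply: xget_unique; first by split; [exact: pZ|exact: orth].
move=> v [pv orthv]; apply: contrapT => /eqP; rewrite -subr_eq0 => /eqP vZ.
have pd : p (v - 2^-1 *: (Z - dTheta Z)) := fpB hU pv pZ.
have := killing_fp_gt0 killing_neg pd vZ.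
set d := v - _ in pd vZ *.
rewrite {1}(_ : d = (Z - 2^-1 *: (Z - dTheta Z)) - (Z - v)); last first.
  by rewrite opprB addrC addrA subrK.
by rewrite killingBl orth// orthv// subrr ltxx.
Qed.

Lemma hilbD X Y : hilb P (X + Y) = hilb P X + hilb P Y.
Proof.
rewrite /hilb; move: (proj_minus P) (proj_plus P) => f1 f2.
by rewrite (linearD f1) (linearD f2) /= !scalerDr opprD addrACA.
Qed.

Lemma hilbZ c X : hilb P (c *: X) = c *: hilb P X.
Proof.
rewrite /hilb; move: (proj_minus P) (proj_plus P) => f1 f2.
rewrite [f1 (c *: X)]linearZ [f2 (c *: X)]linearZ /=.
by rewrite scalerDr scalerN !scalerA ![c * 'i]mulrC.
Qed.

Section AtPoint.
Variable g0 : M.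
Hypothesis hg0 : grpG0 U Theta g0.

Let Zof X := Ad (invmx g0) (hilb P (Ad g0 X)).

Lemma Zof_g0 X : p X -> fg0 U dTheta (Zof X).
Proof.
move=> pX; apply: (grpG0_Ad hU hTheta (grpG0V hU hTheta hg0)).
apply: (hilb_g0 hU hTheta ht0 hP); apply: (grpG0_Ad hU hTheta hg0).
exact: (fp_fg0 hU hTheta pX).
Qed.

Lemma OmegaE X : p X -> Omega P g0 X = 2^-1 *: (Zof X - dTheta (Zof X)).
Proof. by move=> /Zof_g0 /orth_projE. Qed.

Lemma OmegaD X Y : p X -> p Y -> Omega P g0 (X + Y) = Omega P g0 X + Omega P g0 Y.
Proof.
move=> pX pY; rewrite (OmegaE pX) (OmegaE pY) (OmegaE (fpD hU pX pY)).
rewrite -scalerDr; congr (_ *: _).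
by rewrite /Zof Ad_add hilbD Ad_add linearD /= opprD addrACA.
Qed.

Lemma OmegaZ (t : R) X : p X -> Omega P g0 (t%:C%C *: X) = t%:C%C *: Omega P g0 X.
Proof.
move=> pX; rewrite (OmegaE pX) (OmegaE (fpZ t pX)).
rewrite scalerA [_ * 2^-1]mulrC -scalerA; congr (_ *: _).
by rewrite /Zof Ad_scale hilbZ Ad_scale linearZ /= scalerBr.
Qed.

(** Removing from a preimage of x its orthogonal projection onto the kernel of
    Omega g0, a real subspace of p, gives a preimage orthogonal to that kernel. *)
Lemma Omega_invP x : leaf_tangent P g0 x ->
  p (Omega_inv P g0 x) /\ Omega P g0 (Omega_inv P g0 x) = x.
Proof.
move=> [phi pphi Ophi].
pose W := [set psi | p psi /\ Omega P g0 psi = 0].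
have Om0 : Omega P g0 0 = 0.
  have -> : (0 : M) = (0 : R)%:C%C *: 0 by rewrite scaler0.
  by rewrite OmegaZ ?scale0r//; exact: fp0.
have sW : real_subspace W.
  split.
  - by split; [exact: fp0|].
  - by move=> X Y [pX X0] [pY Y0]; split; [exact: fpD|rewrite OmegaD// X0 Y0 addr0].
  - by move=> t X [pX X0]; split; [exact: fpZ|rewrite OmegaZ// X0 scaler0].
have Wp : W `<=` p by move=> w [].
have [w [pw w0] orth] := fp_orth_proj hU killing_neg sW Wp pphi.
suff [] : [set phi | [/\ p phi, Omega P g0 phi = x &
    forall psi, p psi -> Omega P g0 psi = 0 -> killing phi psi = 0]] (Omega_inv P g0 x).
  by [].
apply: xgetPex; exists (phi - w); split.
- exact: (fpB hU pphi pw).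
- rewrite (OmegaD pphi (fpN pw)) Ophi -scaleN1r -(rmorphN1 (real_complex R)) OmegaZ// w0.
  by rewrite scaler0 addr0.
- by move=> psi ppsi psi0; exact: orth.
Qed.

Variables (l a k : M).
Hypotheses (hl : grpNminus P l) (ha : grpA U dTheta t0 a) (hk : U k).
Hypothesis eg0 : g0 = l *m a *m k.

(** Let xi = Ad(g0) phi and b = l a. On g the operator hilb is i up to b^-, with
    hilb xi = i xi - i xi_0 - 2i xi_-. Applying Ad(b^-1), which preserves b^- and is the
    identity modulo n^- on h, gives Ad(k) Z = i Ad(k) phi + beta with Z = Zof phi and beta
    in -i xi_0 + n^-. As Z = x + K with x = Omega g0 phi Hermitian and K skew, the
    Hermitian Ad(k) x and the skew Ad(k) K - i Ad(k) phi add up to beta, and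
    hilb_hermitian_skew applies. *)
Lemma leaf_components phi : p phi ->
  exists T Y A B K, [/\ t0 T, fa0 U dTheta t0 Y,
    A \in nminus P /\ B \in nplus P,
    Ad k (Omega P g0 phi) = A - 'i *: T + B &
    [/\ K \in g, dTheta K = K &
    hilb P (Ad k (Omega P g0 phi)) =
    - ('i *: Ad k K) - Ad k phi + Y]].
Proof.
move=> pphi; have [Gg0 _] := hg0.
have [gu gg _] := grpG_preserves hU Gg0.
have [ku kg _] := U_preserves hU hk.
have gphi := fp_fg pphi.
pose xi := Ad g0 phi; pose Z := Zof phi.
have g0xi : fg0 U dTheta xi := grpG0_Ad hU hTheta hg0 (fp_fg0 hU hTheta pphi).
have [A1 [H1 [B1 [nA1 hH1 nB1 exi]]]] := tri_decomp hP (proj1 g0xi).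
have g0H1 : fg0 U dTheta H1.
  have [] := g0_components hU hTheta ht0 hP nA1 hH1 nB1 _ => //.
  by rewrite -exi.
have h0H1 := h_g0 hU hTheta killing_neg ht0 hH1 g0H1.
have ehilb : hilb P xi = 'i *: xi + (- ('i *: H1) + - (2%:R * 'i) *: A1).
  rewrite exi (hilbE hP nA1 hH1 nB1).
  by apply/matrixP => i j; rewrite !mxE; ring.
have bu : l *m a \in unitmx.
  by move: gu; rewrite eg0 unitmx_mul => /andP[].
have eb W : Ad (invmx (l *m a)) W = Ad k (Ad (invmx g0) W).
  by rewrite eg0 (invmxM bu ku) [in RHS]AdM ?unitmx_inv// AdVK.
have niH1 : - ('i *: H1) \in h by rewrite memvN; exact: memvZ.
have nA1' : - (2%:R * 'i) *: A1 \in nminus P := memvZ _ nA1.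
have [A2 nA2 eA2] := Ad_borel hU hTheta killing_neg ht0 hP hl ha niH1 nA1'.
have eZ : Ad k Z = 'i *: Ad k phi + (A2 - 'i *: H1).
  rewrite -eb ehilb Ad_add Ad_scale (eb xi) /xi (AdK _ gu).
  by congr (_ + _); rewrite eA2 addrC.
have [gK TK cK eZK] := fk_part (Zof_g0 pphi).
rewrite -(OmegaE pphi) in eZK.
set K := 2^-1 *: _ in gK TK cK eZK; set x := Omega P g0 phi in eZK *.
have px : p x by rewrite /x (OmegaE pphi); exact: fp_part (Zof_g0 pphi).
have cAd W : ctr (Ad k W) = Ad k (ctr W).
  have kunit : k \is unitarymx by case: hU => _ + _; exact.
  by rewrite /Ad !ctrM (invmx_unitary kunit) trmxCK mulmxA.
have cv : ctr (Ad k x) = Ad k x by rewrite cAd (fp_ctr hU px).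
have ckap : ctr (Ad k K - 'i *: Ad k phi) = - (Ad k K - 'i *: Ad k phi).
  by rewrite ctrB ctrZ !cAd cK (fp_ctr hU pphi) conjCi scaleNr Ad_opp opprB opprK addrC.
have ekv : (Ad k K - 'i *: Ad k phi) + Ad k x = A2 - 'i *: H1.
  move: eZ; rewrite {1}/Z eZK Ad_add => eZ.
  by rewrite addrAC [Ad k K + _]addrC eZ addrAC subrr add0r.
have [T [Y [A' [B' [tT aY nAB ev eh]]]]] :=
  hilb_hermitian_skew hU hTheta ht0 hP (kg _ (fp_fg px)) cv ckap nA2 h0H1 ekv.
exists T, Y, A', B', K; split=> //; split=> //.
by rewrite eh scalerBr opprB scalerA i2E scaleN1r [X in X + Y]addrC.
Qed.

(** Pair the formula for hilb with Ad(k) y, y in p. The term in K vanishes because k and p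
    are orthogonal. The term in Y in a0 sees only the component of Ad(k) y in h; for y
    tangent to the leaf this is a multiple of an element of t0, which is orthogonal to
    a0. What is left is -<phi,y>. *)
Lemma omega_leaf phi psi : p phi -> p psi ->
  killing (Ad (invmx k) (hilb P (Ad k (Omega P g0 phi)))) (Omega P g0 psi) =
  - killing phi (Omega P g0 psi).
Proof.
move=> pphi ppsi.
have hkk := U_preserves hU hk; have [ku kg _] := hkk.
have [T [Y [A [B [K [tT aY nAB _ [gK TK ->]]]]]]] := leaf_components pphi.
have [T' [Y' [A' [B' [K' [tT' aY' [nA' nB'] ey _]]]]]] := leaf_components ppsi.
have py : p (Omega P g0 psi) by rewrite (OmegaE ppsi); exact: fp_part (Zof_g0 ppsi).
move: (Omega P g0 psi) py ey => y py ey; have gy := fp_fg py.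
have gphi := fp_fg pphi.
have hY : Y \in h by case: aY => hY _; exact: h0_h.
have gY := h_g hY.
rewrite (killing_AdV hU hkk _ gy); last first.
  by apply: memvD gY; apply: memvB (kg _ gphi); rewrite memvN; exact: memvZ (kg _ gK).
rewrite killingDl killingBl killingNl killingZl !(killing_Ad hU hkk)//.
rewrite (killing_eigen_orth hU hTheta gK gy TK); last by case: py.
rewrite mulr0 oppr0 sub0r ey !killingDr -scaleNr killingZr.
rewrite (killing_h_nminus hU hTheta killing_neg ht0 hP hY nA').
rewrite (killing_h_nplus hU hTheta killing_neg ht0 hP hY nB').
by rewrite (killing_t0_a0 hU hTheta ht0 tT' aY) mulr0 !addr0.
Qed.

End AtPoint.
End Main.

Theorem theorem3p5 (R : realType) (n : nat)
  (U : set 'M[R[i]]_n)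
  (hU : compact_unitary_group U)
  (hU1 : simply_connected R U)
  (Theta : 'M[R[i]]_n -> 'M[R[i]]_n) (dTheta : 'End('M[R[i]]_n))
  (hTheta : holomorphic_involution U Theta dTheta)
  (hX : irreducible_compact_type U Theta dTheta)
  (t0 : set 'M[R[i]]_n)
  (ht0 : maximal_abelian U Theta t0)
  (P : set 'Hom(subvs_of (fh U dTheta t0), R[i]^o))
  (hP : theta_stable_triangular P)
  (l a u : 'M[R[i]]_n -> 'M[R[i]]_n)
  (hlau : iwasawa P l a u)
  (g0 : 'M[R[i]]_n) (hg0 : grpG0 U Theta g0)
  (x y : 'M[R[i]]_n)
  (hx : leaf_tangent P g0 x) (hy : leaf_tangent P g0 y) :
  Pi_inv P g0 x y = - omega P u 1%:M g0 x y.
Proof.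
have killing_neg : forall X, fu U X -> X <> 0 -> killing U X X < 0 by case: hX.
have [pphi Ophi] := Omega_invP hU hTheta killing_neg ht0 hP hg0 hx.
have [psi ppsi Opsi] := hy.
have [hl ha hu eg0] := hlau g0 (proj1 hg0).
rewrite /Pi_inv /omega mul1mx -{2}Ophi -Opsi.
rewrite (omega_leaf hU hTheta killing_neg ht0 hP hg0 hl ha hu eg0 pphi ppsi).
by rewrite opprK.
Qed.
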